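(* Let $G$ be a finitely generated group and let $d(G)$ be the minimal number of generators of $G$. Let $S$ be a simplicial $G$–tree with finite quotient graph $\overline S=G\backslash S$ in which every edge stabilizer is finite. Then for any compressing forest $F$ of $\overline S$, $$\eta(S)=\sum_{e\in E\overline S\setminus EF}\frac{1}{|G(e)|}\le d(G),$$ where $G(e)$ is the stabilizer of a lift of $e$ to $S$.
   Context: For a simplicial $G$–tree $S$ with finite quotient graph $\overline S=G\backslash S$, denote by $G(v)$, $G(e)$ the stabilizers in $G$ of chosen lifts of a vertex $v$ or edge $e$ of $\overline S$ (compatible, so that for an edge from $\iota e$ to $\tau e$ its stabilizer is a subgroup of the stabilizers of the lifted endpoints). A compressing forest is a subgraph $F$ of $\overline S$ containing no cycle, with $VF=V\overline S$, whose edges are oriented so that each vertex has at most one edge of $F$ oriented away from it, such that every edge $e\in EF$ oriented from $\iota e$ to $\tau e$ satisfies $G(e)=G(\iota e)$ (for the lift of $e$ and its initial vertex), and which is maximal with respect to these properties. Collapsing the $G$–orbits of edges lying over $F$ yields a reduced $G$–tree $S^*$ whose quotient graph $\overline{S^*}$ has edge set $E\overline S\setminus EF$ with the same edge groups; thus $\eta(S)=\sum_{e\in E\overline{S^*}}1/|G(e)|$. *)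

(* Defs.v *)
From HB Require Import structures.
From mathcomp Require Import all_boot all_order all_algebra.
From Stdlib Require List.
Set Implicit Arguments. Unset Strict Implicit. Unset Printing Implicit Defensive.

Record group_on (G : Type) := GroupOn {
  gmul : G -> G -> G;
  gone : G;
  ginv : G -> G;
  gmulA : forall x y z, gmul x (gmul y z) = gmul (gmul x y) z;
  gmul1 : forall x, gmul gone x = x;
  gmulV : forall x, gmul (ginv x) x = gone }.

Inductive gen_by (G : Type) (grp : group_on G) (S : seq G) : G -> Prop :=
 | gen_in x : List.In x S -> gen_by grp S x
 | gen_one : gen_by grp S (gone grp)
 | gen_mul x y : gen_by grp S x -> gen_by grp S y -> gen_by grp S (gmul grp x y)
 | gen_inv x : gen_by grp S x -> gen_by grp S (ginv grp x).

Definition generates (G : Type) (grp : group_on G) (S : seq G) :=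
  forall g, gen_by grp S g.

Definition min_num_generators (G : Type) (grp : group_on G) (d : nat) :=
  (exists S : seq G, size S = d /\ generates grp S) /\
  (forall S : seq G, generates grp S -> (d <= size S)%N).

Definition has_card (T : Type) (P : T -> Prop) (n : nat) :=
  exists l : seq T, List.NoDup l /\ size l = n /\ (forall x, List.In x l <-> P x).

Section SerreGraph.
Variables (V E : Type) (src : E -> V) (rev : E -> E).
Definition tgt (e : E) : V := src (rev e).

Fixpoint walk (v : V) (es : seq E) (w : V) : Prop :=
  match es with
  | [::] => v = w
  | e :: es' => src e = v /\ walk (tgt e) es' w
  end.

Fixpoint reduced (es : seq E) : Prop :=
  match es with
  | e1 :: ((e2 :: _) as es') => e2 <> rev e1 /\ reduced es'
  | _ => True
  end.

Definition is_tree : Prop :=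
  (exists v : V, True) /\
  (forall v w, exists es, walk v es w) /\
  (forall v es, walk v es v -> reduced es -> es = [::]).
End SerreGraph.

Record Gtree (G : Type) (grp : group_on G) := MkGtree {
  vtx : Type;
  edg : Type;
  src : edg -> vtx;
  rev : edg -> edg;
  revK : forall e, rev (rev e) = e;
  rev_neq : forall e, rev e <> e;
  tree_ax : is_tree src rev;
  actv : G -> vtx -> vtx;
  acte : G -> edg -> edg;
  actv1 : forall v, actv (gone grp) v = v;
  actvM : forall g h v, actv (gmul grp g h) v = actv g (actv h v);
  acte1 : forall e, acte (gone grp) e = e;
  acteM : forall g h e, acte (gmul grp g h) e = acte g (acte h e);
  src_act : forall g e, src (acte g e) = actv g (src e);
  rev_act : forall g e, rev (acte g e) = acte g (rev e);
  no_inversion : forall g e, acte g e <> rev e }.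

Section Quotient.
Variables (G : Type) (grp : group_on G) (T : Gtree grp).

Definition stabV (v : vtx T) (g : G) : Prop := actv g v = v.
Definition stabE (e : edg T) (g : G) : Prop := acte g e = e.

(** Vb, Eb together with pV, pE form the quotient graph G\S:
    vertices = G-orbits of vertices, (geometric) edges = G-orbits of
    edges up to orientation. *)
Definition is_quotient (Vb Eb : Type) (pV : vtx T -> Vb) (pE : edg T -> Eb) :=
  (forall x : Vb, exists v, pV v = x) /\
  (forall v w, pV v = pV w <-> exists g, w = actv g v) /\
  (forall y : Eb, exists e, pE e = y) /\
  (forall e e', pE e = pE e' <->
       exists g, e' = acte g e \/ e' = acte g (rev e)).

Variables (Vb Eb : finType) (pV : vtx T -> Vb) (pE : edg T -> Eb).

Definition qjoins (e : Eb) (x y : Vb) : Prop :=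
  exists et, pE et = e /\ pV (src et) = x /\ pV (tgt (@src _ _ T) (@rev _ _ T) et) = y.

Fixpoint qwalk (x : Vb) (l : seq Eb) (y : Vb) : Prop :=
  match l with
  | [::] => x = y
  | e :: l' => exists z, qjoins e x z /\ qwalk z l' y
  end.

(** F (a set of edges of the quotient, with all vertices) contains a cycle *)
Definition has_cycle (F : {set Eb}) : Prop :=
  exists (x : Vb) (l : seq Eb),
    l <> [::] /\ uniq l /\ (forall e, e \in l -> e \in F) /\ qwalk x l x.

(** orientation of F given by a lift [dir e] of each edge e of F; e is
    oriented from pV (src (dir e)) to pV (tgt (dir e)). *)
Definition oriented_forest (F : {set Eb}) (dir : Eb -> edg T) : Prop :=
  ~ has_cycle F /\
  (forall e, e \in F -> pE (dir e) = e) /\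
  (forall e1 e2, e1 \in F -> e2 \in F ->
      pV (src (dir e1)) = pV (src (dir e2)) -> e1 = e2) /\
  (forall e, e \in F -> forall g, stabE (dir e) g <-> stabV (src (dir e)) g).

Definition compressing_forest (F : {set Eb}) : Prop :=
  (exists dir, oriented_forest F dir) /\
  (forall F' : {set Eb}, F \proper F' -> ~ exists dir, oriented_forest F' dir).
End Quotient.

(* Main.v *)
Require Import Defs.
From mathcomp Require Import all_boot all_order all_algebra.
From mathcomp Require Import lra.
From Stdlib Require Import ClassicalEpsilon FunctionalExtensionality.
From Stdlib Require Import PropExtensionality ProofIrrelevance.
Import Order.TTheory GRing.Theory Num.Theory.
Set Implicit Arguments. Unset Strict Implicit. Unset Printing Implicit Defensive.

(** Subtracting the weights of all vertices would leave those of [Y] in the final bound, so only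
    non-root vertices are subtracted, and the flow condition forces them to be absent once [Y] is
    reached. The price is that each fold must decide whether the identified orbit becomes a root.
    Making it one keeps the flow for free but gives up the subtracted weights of its ends; this is
    often affordable, since a proper inclusion of subgroups at least halves the weight. In the
    remaining cases the orbit stays non-root, its new stabilizer is computed exactly, and an exit
    along an edge with that stabilizer has to be found. The bound d arises from closing one loop per
    generator: each closure gives up the weight of one vertex orbit, which is at most 1. For
    termination the edge sum is measured in units of 1/C!, where C bounds the orders of the edge
    stabilizers of [Y]. *)

(* The sum is bounded by folding a Cayley graph onto the reduced tree, in the
   spirit of the Stallings proof of Grushko's theorem. Collapsing [F] turns the
   tree into a reduced tree [Y] whose edge orbits are the edges outside [F].
   Consider connected G-graphs [X] mapping to [Y], together with an invariant set
   of roots such that every vertex can be pushed to a root along edges whose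
   stabilizer is that of their initial vertex. The quantity
     sum over edge orbits of 1/|G(e)| - sum over non-root vertex orbits of 1/|G(v)|
   is at most d for a subdivided Cayley graph on d generators, and it does not
   increase when two edges with a common end and the same image are folded
   (the roots being adapted). A fold strictly decreases the sum over edge orbits,
   whose values have bounded denominators, so folding stops at a graph immersed
   in [Y]. As [Y] is a reduced tree, that graph is [Y] itself and has no non-root
   vertex. *)

Local Notation pselect := excluded_middle_informative.

Lemma pred_ext (T : Type) (P Q : T -> Prop) : (forall x, P x <-> Q x) -> P = Q.
Proof.
by move=> PQ; apply: functional_extensionality => x; apply: propositional_extensionality.
Qed.

Lemma exist_inj (T : Type) (P : T -> Prop) (x y : {x | P x}) :
  sval x = sval y -> x = y.
Proof.
case: x y => [x Px] [y Py] /= xy; subst y.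
by rewrite (proof_irrelevance _ Px Py).
Qed.

(** A class is the predicate [R x], and choice provides the section [s], through which actions and
    maps on the quotient are defined. *)
Lemma quotient_exists (M : Type) (R : M -> M -> Prop) :
  (forall x, R x x) -> (forall x y, R x y -> R y x) ->
  (forall x y z, R x y -> R y z -> R x z) ->
  exists (Q : Type) (p : M -> Q) (s : Q -> M),
    (forall q, p (s q) = q) /\ (forall x y, p x = p y <-> R x y).
Proof.
move=> Rr Rs Rt.
pose Q := {P : M -> Prop | exists x, P = R x}.
pose p x : Q := exist _ (R x) (ex_intro _ x erefl).
have pS q : exists x, p x = q.
  by case: q => P [x Px]; exists x; apply: exist_inj; rewrite /= Px.
exists Q, p, (fun q => sval (constructive_indefinite_description _ (pS q))).
split=> [q|x y]; first by case: constructive_indefinite_description.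
split=> [/(f_equal sval)/= e|xy].
  by rewrite e; apply: Rr.
apply: exist_inj => /=; apply: pred_ext => z; split=> h.
  by apply: (Rt _ x) => //; apply: Rs.
by apply: (Rt _ y).
Qed.

Section Folding.
Variables (G : Type) (grp : group_on G).
Local Notation "x ** y" := (gmul grp x y) (at level 40, left associativity).
Local Notation e1 := (gone grp).
Local Notation "x ^!" := (ginv grp x) (at level 1, format "x ^!").

(** * Weights of subgroups *)

Lemma mulgV x : x ** x^! = e1.
Proof.
rewrite -[LHS](gmul1 grp) -{1}(gmulV grp x^!) -gmulA (gmulA grp x^!) gmulV gmul1.
exact: gmulV.
Qed.

Lemma mulg1 x : x ** e1 = x.
Proof. by rewrite -(gmulV grp x) gmulA mulgV gmul1. Qed.

Lemma mulKg x y : x^! ** (x ** y) = y.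
Proof. by rewrite gmulA gmulV gmul1. Qed.

Lemma mulVKg x y : x ** (x^! ** y) = y.
Proof. by rewrite gmulA mulgV gmul1. Qed.

Lemma mulgI x y z : x ** y = x ** z -> y = z.
Proof. by move=> e; rewrite -(mulKg x y) e mulKg. Qed.

Lemma mulIg x y z : y ** x = z ** x -> y = z.
Proof. by move=> e; rewrite -(mulg1 y) -(mulgV x) gmulA e -gmulA mulgV mulg1. Qed.

Lemma invgK x : x^!^! = x.
Proof. by apply: (@mulgI x^!); rewrite mulgV gmulV. Qed.

Record subgroup (P : G -> Prop) : Prop := Subgroup {
  sub1 : P e1;
  subM : forall x y, P x -> P y -> P (x ** y);
  subV : forall x, P x -> P x^! }.

Definition fin (P : G -> Prop) := exists n, has_card P n.

(* An infinite subgroup has weight 0. *)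
Definition wt (P : G -> Prop) : rat :=
  match pselect (fin P) with
  | left h => (sval (constructive_indefinite_description _ h))%:R^-1%R
  | right _ => 0%R
  end.

Lemma size_length (T : Type) (l : seq T) : size l = length l.
Proof. by elim: l => //= x l ->. Qed.

Lemma has_card_inj (T U : Type) (f : T -> U) (P : T -> Prop) (Q : U -> Prop) m n :
  injective f -> (forall x, P x -> Q (f x)) ->
  has_card P m -> has_card Q n -> (m <= n)%N.
Proof.
move=> fI PQ [l [ul [<- lP]]] [k [uk [<- kQ]]].
rewrite !size_length -(List.length_map f l); apply/ssrnat.leP.
apply: List.NoDup_incl_length.
  by apply: List.NoDup_map_NoDup_ForallPairs => // x y _ _; apply: fI.
by move=> y /List.in_map_iff [x [<- /lP /PQ /kQ]].
Qed.

Lemma has_card_uniq (P : G -> Prop) m n : has_card P m -> has_card P n -> m = n.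
Proof.
move=> hm hn; apply/eqP; rewrite eqn_leq.
by rewrite (@has_card_inj _ _ id P P m n) // (@has_card_inj _ _ id P P n m).
Qed.

Lemma has_card_sub (P Q : G -> Prop) :
  (forall x, P x -> Q x) -> fin Q -> fin P.
Proof.
move=> PQ [n [l [ul [_ lQ]]]].
pose l' := List.filter (fun x => if pselect (P x) then true else false) l.
exists (size l'), l'; split; first exact: List.NoDup_filter.
split=> // x; split.
  by move=> /List.filter_In [_]; case: pselect.
move=> Px; apply/List.filter_In; split; first by apply/lQ/PQ.
by case: pselect.
Qed.

Lemma has_card_gt0 P n : subgroup P -> has_card P n -> (0 < n)%N.
Proof.
move=> sP [l [_ [<- lP]]].
by case: l lP => // lP; case: (lP e1) => _ /(_ (sub1 sP)).
Qed.

(** For [g] in [Q] outside [P], the cosets [P] and [gP] are disjoint subsets of [Q]. *)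
Lemma has_card_half (P Q : G -> Prop) m n :
  subgroup P -> subgroup Q -> (forall x, P x -> Q x) ->
  ~ (forall x, Q x -> P x) -> has_card P m -> has_card Q n -> (m.*2 <= n)%N.
Proof.
move=> sP sQ PQ nQP [l [ul [<- lP]]] [k [uk [<- kQ]]].
have [g [Qg nPg]] : exists g, Q g /\ ~ P g.
  apply: Classical_Prop.NNPP => h; apply: nQP => x Qx.
  by apply: Classical_Prop.NNPP => nPx; apply: h; exists x.
pose l2 := List.app l (List.map (gmul grp g) l).
have <- : length l2 = (size l).*2.
  by rewrite List.length_app List.length_map size_length -addnn.
rewrite size_length; apply/ssrnat.leP; apply: List.NoDup_incl_length.
  apply: List.NoDup_app => //.
    by apply: List.NoDup_map_NoDup_ForallPairs => // x y _ _; apply: mulgI.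
  move=> x /lP Px /List.in_map_iff [y [xy /lP Py]]; apply: nPg.
  have -> : g = x ** y^! by rewrite -xy -gmulA mulgV mulg1.
  by apply: (subM sP) => //; apply: (subV sP).
move=> x /List.in_app_iff [/lP /PQ /kQ //|/List.in_map_iff [y [<- /lP /PQ Qy]]].
by apply/kQ; apply: (subM sQ).
Qed.

Lemma wtE P n : has_card P n -> wt P = (n%:R^-1)%R.
Proof.
move=> h; rewrite /wt; case: pselect => [f|[]]; last by exists n.
case: constructive_indefinite_description => m hm /=.
by rewrite (has_card_uniq hm h).
Qed.

Lemma wt_inf P : ~ fin P -> wt P = 0%R.
Proof. by rewrite /wt; case: pselect. Qed.

Lemma wt_gt0 P : subgroup P -> fin P -> (0 < wt P)%R.
Proof.
move=> sP [n h]; rewrite (wtE h) invr_gt0 ltr0n.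
exact: has_card_gt0 h.
Qed.

Lemma wt_ge0 P : (0 <= wt P)%R.
Proof.
case: (pselect (fin P)) => [[n h]|/wt_inf -> //].
by rewrite (wtE h) invr_ge0 ler0n.
Qed.

Lemma wt_le1 P : subgroup P -> (wt P <= 1)%R.
Proof.
move=> sP; case: (pselect (fin P)) => [[n h]|/wt_inf -> //].
rewrite (wtE h) invf_le1 ?ltr0n ?ler1n; exact: has_card_gt0 h.
Qed.

Lemma wt_sub P Q : subgroup P -> (forall x, P x -> Q x) -> fin P ->
  (wt Q <= wt P)%R.
Proof.
move=> sP PQ [m h]; case: (pselect (fin Q)) => [[n k]|/wt_inf ->]; last exact: wt_ge0.
have mn : (m <= n)%N := @has_card_inj _ _ id P Q m n (fun _ _ => id) PQ h k.
have m0 := has_card_gt0 sP h.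
by rewrite (wtE h) (wtE k) lef_pV2 ?ler_nat // posrE ltr0n // (leq_trans m0).
Qed.

Lemma wt_half P Q : subgroup P -> subgroup Q -> (forall x, P x -> Q x) ->
  fin P -> ~ (forall x, Q x -> P x) -> (2 * wt Q <= wt P)%R.
Proof.
move=> sP sQ PQ [m h] nQP.
case: (pselect (fin Q)) => [[n k]|/wt_inf ->]; last by rewrite mulr0 wt_ge0.
have mn := has_card_half sP sQ PQ nQP h k.
have m0 := has_card_gt0 sP h; have n0 := has_card_gt0 sQ k.
rewrite (wtE h) (wtE k) ler_pdivrMr ?ltr0n // mulrC ler_pdivlMr ?ltr0n //.
by rewrite -natrM ler_nat mul2n.
Qed.

(** A proper inclusion would halve a positive weight. Stabilizers are shown to coincide in this way,
    by comparing weights along a flow. *)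
Lemma wt_sub_eq P Q : subgroup P -> subgroup Q -> (forall x, P x -> Q x) ->
  fin P -> (wt P <= wt Q)%R -> forall x, Q x -> P x.
Proof.
move=> sP sQ PQ fP le; apply: Classical_Prop.NNPP => n.
have := wt_half sP sQ PQ fP n; have := wt_gt0 sP fP; lra.
Qed.

Lemma has_card_conj P g n : has_card P n -> has_card (fun x => P (g^! ** x ** g)) n.
Proof.
move=> [l [ul [<- lP]]]; exists (List.map (fun x => g ** x ** g^!) l).
split; [|split].
- apply: List.NoDup_map_NoDup_ForallPairs => // x y _ _ /mulIg; exact: mulgI.
- by rewrite !size_length List.length_map.
move=> x; split.
  move=> /List.in_map_iff [y [<- /lP]].
  by rewrite -!gmulA gmulV mulg1 mulKg.
move=> Px; apply/List.in_map_iff; exists (g^! ** x ** g); split; last exact/lP.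
by rewrite -!gmulA mulgV mulg1 mulVKg.
Qed.

Lemma wt_conj P g : wt (fun x => P (g^! ** x ** g)) = wt P.
Proof.
case: (pselect (fin P)) => [[n h]|nf].
  by rewrite (wtE h) (wtE (has_card_conj g h)).
rewrite (wt_inf nf) wt_inf // => -[n /(has_card_conj g^!) h]; apply: nf.
exists n; suff <- : (fun x => P (g^! ** (g^!^! ** x ** g^!) ** g)) = P by [].
by apply: pred_ext => x; rewrite invgK -!gmulA gmulV mulg1 mulKg.
Qed.

(** The order [n] divides [C!], which serves as a common denominator. *)
Lemma wt_int P n C : has_card P n -> (0 < n <= C)%N ->
  exists k : nat, (wt P * (C`!)%:R = k%:R)%R.
Proof.
move=> h /andP[n0 nC]; rewrite (wtE h).
have /dvdnP [q ->] : (n %| C`!)%N by apply: dvdn_fact; rewrite n0.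
exists q; rewrite natrM mulrCA mulVf ?mulr1 // pnatr_eq0.
by rewrite -lt0n.
Qed.

Inductive gsub (S : G -> Prop) : G -> Prop :=
 | gsub_in x : S x -> gsub S x
 | gsub_one : gsub S e1
 | gsub_mul x y : gsub S x -> gsub S y -> gsub S (x ** y)
 | gsub_inv x : gsub S x -> gsub S x^!.

Lemma subgroup_gsub S : subgroup (gsub S).
Proof. by split; [exact: gsub_one|exact: gsub_mul|exact: gsub_inv]. Qed.

Lemma gsub_min (S L : G -> Prop) : subgroup L -> (forall x, S x -> L x) ->
  forall x, gsub S x -> L x.
Proof.
move=> sL SL x; elim=> {x} [x /SL //||x y _ Lx _ Ly|x _ Lx].
- exact: (sub1 sL).
- exact: (subM sL).
- exact: (subV sL).
Qed.

(** * Sets with a group action *)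

Record gset := Gset {
  gcar :> Type;
  act : G -> gcar -> gcar;
  act1 : forall x, act e1 x = x;
  actM : forall g h x, act (g ** h) x = act g (act h x) }.

Definition stab (M : gset) (x : M) (g : G) : Prop := act g x = x.
Definition orb (M : gset) (x y : M) : Prop := exists g, y = act g x.
Definition equivariant (M M' : gset) (f : M -> M') :=
  forall g x, f (act g x) = act g (f x).
Definition ginvariant (M : gset) (P : M -> Prop) := forall g x, P x -> P (act g x).

Section GsetTheory.
Variable M : gset.
Implicit Types x y z : M.

Lemma actK g x : act g^! (act g x) = x.
Proof. by rewrite -actM gmulV act1. Qed.

Lemma actVK g x : act g (act g^! x) = x.
Proof. by rewrite -actM mulgV act1. Qed.

Lemma act_inj g x y : act g x = act g y -> x = y.
Proof. by move=> e; rewrite -(actK g x) e actK. Qed.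

Lemma subgroup_stab x : subgroup (stab x).
Proof.
split; rewrite /stab; first exact: act1.
  by move=> g h hg hh; rewrite actM hh hg.
by move=> g hg; rewrite -{1}hg actK.
Qed.

Lemma orb_refl x : orb x x.
Proof. by exists e1; rewrite act1. Qed.

Lemma orb_sym x y : orb x y -> orb y x.
Proof. by move=> [g ->]; exists g^!; rewrite actK. Qed.

Lemma orb_trans x y z : orb x y -> orb y z -> orb x z.
Proof. by move=> [g ->] [h ->]; exists (h ** g); rewrite actM. Qed.

Lemma orb_act x g : orb x (act g x).
Proof. by exists g. Qed.

Lemma orb_actr x y g : orb x (act g y) <-> orb x y.
Proof.
split=> h; last exact: orb_trans h (orb_act _ _).
exact: orb_trans h (orb_sym (orb_act _ _)).
Qed.

Lemma stab_act g h x : stab (act g x) h <-> stab x (g^! ** h ** g).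
Proof.
rewrite /stab !actM; split=> [->|e]; first exact: actK.
by apply: (@act_inj g^!); rewrite actK.
Qed.

Lemma wt_stab_orb x y : orb x y -> wt (stab y) = wt (stab x).
Proof.
move=> [g ->]; rewrite -(wt_conj (stab x) g); congr wt; apply: pred_ext => h.
exact: stab_act.
Qed.

Lemma ginvariantE (P : M -> Prop) g x : ginvariant P -> P (act g x) <-> P x.
Proof. by move=> iP; split=> [/(iP g^!)|/iP //]; rewrite actK. Qed.

End GsetTheory.

Lemma stab_equi (M M' : gset) (f : M -> M') : equivariant f ->
  forall x g, stab x g -> stab (f x) g.
Proof. by move=> ef x g sx; rewrite /stab -ef sx. Qed.

Lemma orb_equi (M M' : gset) (f : M -> M') : equivariant f ->
  forall x y, orb x y -> orb (f x) (f y).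
Proof. by move=> ef x y [g ->]; exists g; rewrite ef. Qed.

(* [osum P s]: the set [P] is a union of finitely many orbits and [s] is the sum
   over these orbits of 1/|stabilizer|. *)
Inductive osum (M : gset) : (M -> Prop) -> rat -> Prop :=
 | osum0 P : (forall x, ~ P x) -> osum P 0%R
 | osumS P p s : P p -> osum (fun x => P x /\ ~ orb p x) s ->
     osum P (wt (stab p) + s)%R.

Lemma osum_ext (M : gset) (P Q : M -> Prop) s :
  (forall x, P x <-> Q x) -> osum P s -> osum Q s.
Proof. by move=> /pred_ext ->. Qed.

(** A derivation of [osum] lists the orbits in one particular order; exchanging neighbours brings
    any orbit to the front. *)
Lemma osum_rem (M : gset) (P : M -> Prop) s p : osum P s -> P p ->
  osum (fun x => P x /\ ~ orb p x) (s - wt (stab p))%R.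
Proof.
move=> h; elim: h p => {P s} [P nP p /nP //|P p0 s Pp0 h IH p Pp].
case: (pselect (orb p0 p)) => o.
  rewrite (wt_stab_orb o) [(_ + s)%R]addrC addrK; apply: osum_ext h => x.
  split=> -[Px nx]; split=> // ox; apply: nx.
    exact: orb_trans o ox.
  exact: orb_trans (orb_sym o) ox.
rewrite -addrA; apply: osumS.
  by split=> // /orb_sym.
by apply: osum_ext (IH p (conj Pp o)) => x; tauto.
Qed.

Lemma osum_empty (M : gset) (P : M -> Prop) s :
  osum P s -> (forall x, ~ P x) -> s = 0%R.
Proof. by case=> // {}P p {}s Pp _ /(_ p). Qed.

Lemma osum_bij (M M' : gset) (f : M -> M') (P : M -> Prop) (P' : M' -> Prop) s :
  equivariant f -> ginvariant P ->
  (forall x, P x -> P' (f x)) -> (forall y, P' y -> exists x, P x /\ f x = y) ->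
  (forall x y, P x -> P y -> f x = f y -> x = y) ->
  osum P s -> osum P' s.
Proof.
move=> ef iP PP' P'P fI h; elim: h P' iP PP' P'P fI => {P s} [P nP|P p s Pp h IH] P' iP PP' P'P fI.
  by apply: osum0 => y /P'P [x [/nP]].
have -> : stab p = stab (f p).
  apply: pred_ext => g; split; first exact: stab_equi.
  by rewrite /stab -ef => /fI; apply=> //; apply: iP.
apply: osumS; first exact: PP'.
have oP x : P x -> orb (f p) (f x) -> orb p x.
  move=> Px [g]; rewrite -ef => /fI -> //; first exact: orb_act.
  exact: iP.
apply: IH.
- by move=> g x [Px nx]; split; [exact: iP|rewrite orb_actr].
- by move=> x [Px nx]; split; [exact: PP'|move/(oP _ Px)].
- move=> y [/P'P [x [Px <-]] nx]; exists x; split=> //; split=> // o.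
  by apply: nx; apply: orb_equi.
- by move=> x y [Px _] [Py _]; apply: fI.
Qed.

Lemma osum_int (M : gset) (P : M -> Prop) s C : osum P s ->
  (forall x, P x -> exists n, has_card (stab x) n /\ (n <= C)%N) ->
  exists k : nat, (s * (C`!)%:R = k%:R)%R.
Proof.
elim=> {P s} [P _ _|P p s Pp _ IH fP]; first by exists 0%N; rewrite mul0r.
have [|k ek] := IH; first by move=> x [/fP].
have [n [hn nC]] := fP _ Pp.
have [|m em] := wt_int hn (C := C).
  by rewrite nC andbT; apply: has_card_gt0 hn; apply: subgroup_stab.
by exists (m + k)%N; rewrite mulrDl ek em natrD.
Qed.

(** * Identifying two points of a G-set *)

Definition ind (P : Prop) (r : rat) : rat := if pselect P then r else 0%R.

Lemma indT (P : Prop) r : P -> ind P r = r.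
Proof. by rewrite /ind; case: pselect. Qed.

Lemma indF (P : Prop) r : ~ P -> ind P r = 0%R.
Proof. by rewrite /ind; case: pselect. Qed.

(* [p] is the quotient of a G-set that identifies [a] with [c]. *)
Record is_merge (M M' : gset) (p : M -> M') (a c : M) : Prop := IsMerge {
  merge_equi : equivariant p;
  merge_surj : forall y, exists x, p x = y;
  merge_eq : p a = p c;
  merge_sep : forall x y, p x = p y ->
    x = y \/ ((orb a x \/ orb c x) /\ (orb a y \/ orb c y));
  merge_stab : forall L, subgroup L ->
    (forall g, stab a g -> L g) -> (forall g, stab c g -> L g) ->
    (forall g, act g a = c -> L g) -> forall g, stab (p a) g -> L g }.

Lemma is_merge_sym (M M' : gset) (p : M -> M') a c :
  is_merge p a c -> is_merge p c a.
Proof.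
case=> h1 h2 h3 h4 h5; split=> //.
  by move=> x y /h4; tauto.
rewrite -h3 => L sL La Lc Lac; apply: h5 => // g gac.
by rewrite -(invgK g); apply: (subV sL); apply: Lac; rewrite -gac actK.
Qed.

(** The merged orbit is the coset space G/H, where [H] is generated by the stabilizers of [a] and
    [c] and the elements moving [a] to [c]. Here [ac k x] says that [x] lies in the translate
    k{a,c}, and [R] joins points of translates whose indices lie in the same coset of [H]. *)
Lemma merge_exists (M : gset) (a c : M) :
  exists (M' : gset) (p : M -> M'), is_merge p a c /\
    (forall (Z : gset) (f : M -> Z), equivariant f -> f a = f c ->
       exists f' : M' -> Z, equivariant f' /\ forall x, f' (p x) = f x).
Proof.
pose S h := [\/ act h a = a, act h c = c | act h a = c].
pose H := gsub S.
have sH : subgroup H := subgroup_gsub S.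
pose ac k x := x = act k a \/ x = act k c.
pose R x y := x = y \/ exists k h, H h /\ ac k x /\ ac (k ** h) y.
(* Two translates of {a,c} that share a point have indices in the same coset of [H]. *)
have acH k m y : ac k y -> ac m y -> H (k^! ** m).
  have E u v w w' : act u w = act v w' -> act (u^! ** v) w' = w.
    by move=> e; rewrite actM -e actK.
  move=> [->|->] [|] /E e.
  - by apply: gsub_in; constructor 1.
  - rewrite -(invgK (_ ** _)); apply: gsub_inv; apply: gsub_in; constructor 3.
    by rewrite -e actK.
  - by apply: gsub_in; constructor 3.
  - by apply: gsub_in; constructor 2.
have Rr x : R x x by left.
have Rs x y : R x y -> R y x.
  case=> [->|[k [h [Hh [kx ky]]]]]; first by left.
  right; exists (k ** h), h^!; split; first exact: gsub_inv.
  by rewrite -gmulA mulgV mulg1.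
have Rt x y z : R x y -> R y z -> R x z.
  case=> [->//|[k [h [Hh [kx ky]]]]].
  case=> [<-|[k' [h' [Hh' [ky' kz]]]]]; first by right; exists k, h.
  right; exists k, (h ** (((k ** h)^! ** k') ** h')); split.
    by apply: gsub_mul => //; apply: gsub_mul => //; apply: acH ky ky'.
  split=> //; suff <- : k' ** h' = k ** (h ** (((k ** h)^! ** k') ** h')) by [].
  by rewrite gmulA -(gmulA _ (k ** h)^!) mulVKg.
have aca g k x : ac k x -> ac (g ** k) (act g x).
  by move=> [->|->]; [left|right]; rewrite actM.
have Ra g x y : R x y -> R (act g x) (act g y).
  case=> [->|[k [h [Hh [kx ky]]]]]; first by left.
  right; exists (g ** k), h; split=> //; split; first exact: aca.
  by rewrite -gmulA; apply: aca.
have [Q [p [s [ps pR]]]] := quotient_exists Rr Rs Rt.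
have pa g x : p (act g (s (p x))) = p (act g x).
  by apply/pR; apply: Ra; apply/pR; rewrite ps.
pose aQ g q := p (act g (s q)).
have aQ1 q : aQ e1 q = q by rewrite /aQ act1 ps.
have aQM g h q : aQ (g ** h) q = aQ g (aQ h q) by rewrite /aQ pa actM.
pose M' := Gset aQ1 aQM.
have pe : equivariant (p : M -> M') by move=> g x; rewrite /= /aQ pa.
exists M', p; split; first split=> //.
- by move=> y; exists (s y).
- apply/pR; right; exists e1, e1; split; first exact: gsub_one.
  by split; [left; rewrite act1 | right; rewrite mulg1 act1].
- have acO k x : ac k x -> orb a x \/ orb c x.
    by move=> [->|->]; [left|right]; apply: orb_act.
  by move=> x y /pR [->|[k [h [_ [/acO kx /acO ky]]]]]; [left|right].
- move=> L sL La Lc Lac.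
  have HL g : H g -> L g.
    by apply: gsub_min => // x [/La|/Lc|/Lac].
  move=> g; rewrite /stab -pe => /pR [/La //|[k [h [Hh [kx ky]]]]].
  apply: HL.
  have Hk : H k.
    have Hkh : H (e1^! ** (k ** h)) by apply: (acH _ _ a _ ky); left; rewrite act1.
    have -> : k = (e1^! ** (k ** h)) ** h^!.
      have -> : e1^! = e1 by rewrite -(gmul1 grp e1^!) mulgV.
      by rewrite gmul1 -gmulA mulgV mulg1.
    by apply: gsub_mul => //; apply: gsub_inv.
  have Hkg : H (k^! ** g) by apply: acH kx _; left.
  by rewrite -(mulVKg k g); apply: gsub_mul.
move=> Z f fe fac.
(* Each generator of [H] fixes the common value [f a = f c], so [f] is constant on classes. *)
have fH h : H h -> act h (f a) = f a.
  apply: (gsub_min (subgroup_stab (f a))) => x [e|e|e]; rewrite /stab.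
  - by rewrite -fe e.
  - by rewrite fac -fe e.
  - by rewrite -fe e.
have fR x y : R x y -> f x = f y.
  have fk k z : ac k z -> f z = act k (f a) by move=> [->|->]; rewrite fe ?fac.
  case=> [->//|[k [h [Hh [/fk -> /fk ->]]]]].
  by rewrite actM (fH _ Hh).
have fp x : f (s (p x)) = f x by apply: fR; apply/pR; rewrite ps.
exists (fun q => f (s q)); split=> // g q /=.
by rewrite /aQ fp fe.
Qed.

(* [flag] tells whether the orbit of the merged point is counted in [P']. *)
Lemma osum_merge (M M' : gset) (p : M -> M') a c (P : M -> Prop) (P' : M' -> Prop)
    (flag : Prop) s :
  is_merge p a c -> ginvariant P ->
  (forall x, P' (p x) <-> (orb (p a) (p x) /\ flag) \/ (~ orb (p a) (p x) /\ P x)) ->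
  osum P s ->
  osum P' (s - ind (P a) (wt (stab a)) - ind (~ orb a c /\ P c) (wt (stab c))
           + ind flag (wt (stab (p a))))%R.
Proof.
move=> mp iP P'E h.
have pe := merge_equi mp.
have rem1 (Q : M -> Prop) x t : ginvariant Q -> osum Q t ->
    osum (fun z => Q z /\ ~ orb x z) (t - ind (Q x) (wt (stab x)))%R.
  move=> iQ hQ; case: (pselect (Q x)) => Qx.
    by rewrite indT //; apply: osum_rem.
  rewrite indF // subr0; apply: osum_ext hQ => z; split=> [Qz|[]//].
  by split=> // -[g zE]; apply: Qx; rewrite zE (ginvariantE _ _ iQ) in Qz.
have iQ : ginvariant (fun z => P z /\ ~ orb a z).
  by move=> g x [Px nx]; split; [apply: iP|rewrite orb_actr].
have := rem1 _ c _ iQ (rem1 _ a _ iP h).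
have -> : ind (P c /\ ~ orb a c) (wt (stab c)) = ind (~ orb a c /\ P c) (wt (stab c)).
  by congr ind; apply: propositional_extensionality; tauto.
set t := (s - _ - _)%R => ht.
have oE x : orb (p a) (p x) <-> orb a x \/ orb c x.
  split=> [[g]|[|]]; last 2 first.
  - exact: orb_equi.
  - by rewrite (merge_eq mp); apply: orb_equi.
  rewrite -pe => /(merge_sep mp) [->|[]//]; left; exact: orb_act.
(* Away from the merged orbit [p] is a bijection, so the remaining sum is carried over unchanged. *)
have ht' : osum (fun y => P' y /\ ~ orb (p a) y) t.
  apply: osum_bij ht => //.
  - by move=> g x [[Px nx] ncx]; rewrite !orb_actr; split=> //; split=> //; apply: iP.
  - move=> x [[Px nx] ncx].
    have nox : ~ orb (p a) (p x) by rewrite oE; tauto.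
    by split=> //; apply/P'E; right.
  - move=> y; have [x <-] := merge_surj mp y.
    rewrite P'E oE => hx; exists x; split=> //; tauto.
  - move=> x y [[_ nx] ncx] _ /(merge_sep mp) [//|[[]//]].
case: (pselect flag) => fl; last first.
  rewrite (indF _ fl) addr0; apply: osum_ext ht' => y; split=> [[]//|].
  have [x <-] := merge_surj mp y; rewrite P'E; tauto.
rewrite (indT _ fl) addrC; apply: osumS => //.
by apply/P'E; left; split=> //; apply: orb_refl.
Qed.

End Folding.

(** * Graphs with a group action *)

Section GGraph.
Variables (G : Type) (grp : group_on G).
Local Notation "x ** y" := (gmul grp x y) (at level 40, left associativity).
Local Notation "x ^!" := (ginv grp x) (at level 1, format "x ^!").
Local Notation stab := (@stab G grp _).
Local Notation orb := (@orb G grp _).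

(* Graphs carry an invariant orientation: [ends true e] is the origin of the
   edge [e] and [ends false e] its terminus. In a walk, the step [(b, e)] goes
   from [ends b e] to [ends (~~ b) e]. *)
Record ggraph := GGraph {
  gV : gset grp;
  gE : gset grp;
  ends : bool -> gE -> gV;
  ends_equi : forall b, equivariant (ends b) }.

Fixpoint gwalk (X : ggraph) (x : gV X) (l : seq (bool * gE X)) (y : gV X) : Prop :=
  match l with
  | [::] => x = y
  | u :: l' => x = ends u.1 u.2 /\ gwalk (ends (~~ u.1) u.2) l' y
  end.

Definition flip (T : Type) (u : bool * T) := (~~ u.1, u.2).
Definition flip_rev (T : Type) (l : seq (bool * T)) := rev (map (@flip T) l).

Lemma flipK T : involutive (@flip T).
Proof. by case=> b e; rewrite /flip /= negbK. Qed.

Fixpoint nobt (T : Type) (l : seq (bool * T)) : Prop :=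
  match l with
  | u :: ((v :: _) as l') => v <> flip u /\ nobt l'
  | _ => True
  end.

Lemma nobt_cons T (u : bool * T) l : nobt (u :: l) -> nobt l.
Proof. by case: l => [//|v l] []. Qed.

Lemma nobt_cat T (l k : seq (bool * T)) u v :
  nobt (l ++ [:: u]) -> nobt (v :: k) -> v <> flip u -> nobt (l ++ u :: v :: k).
Proof.
elim: l => [_ nk vu|w l IH]; first by split.
case: l IH => [IH [uw _] nk vu|w' l IH [w'w h] nk vu]; first by split=> //; split.
by split=> //; apply: IH.
Qed.

Lemma nobt_rev T (l : seq (bool * T)) : nobt l -> nobt (flip_rev l).
Proof.
rewrite /flip_rev; elim: l => [//|u [//|v l] IH [vu /IH]].
rewrite /= !rev_cons -!cats1 => h; rewrite -catA /=; apply: nobt_cat => //.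
by rewrite flipK => e; apply: vu; rewrite -e.
Qed.

Lemma nobt_catl T (l k : seq (bool * T)) :
  nobt l -> nobt k -> (forall u v, List.In u l -> List.In v k -> v <> flip u) ->
  nobt (l ++ k).
Proof.
move=> nl nk lk; elim: l nl lk => [//|u [|v l] IH] nl lk.
  case: k nk lk {IH} => [//|v k] nk lk.
  by split=> //; apply: lk; left.
case: nl => vu nl; split=> //; apply: IH => // w w' ww' kw'.
by apply: lk => //; right.
Qed.

Section Walks.
Variable X : ggraph.
Implicit Types (x y z : gV X) (l k : seq (bool * gE X)).

Lemma gwalk_cat x l y k z : gwalk x l y -> gwalk y k z -> gwalk x (l ++ k) z.
Proof.
elim: l x => [x /= -> //|u l IH x [xu h] hk]; split=> //; exact: IH.
Qed.

Lemma gwalk_rev x l y : gwalk x l y -> gwalk y (flip_rev l) x.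
Proof.
rewrite /flip_rev; elim: l x => [x //=|u l IH x [xu /IH h]].
rewrite /= rev_cons -cats1; apply: gwalk_cat h _.
by rewrite /= negbK.
Qed.

Lemma gwalk_act g x l y : gwalk x l y ->
  gwalk (act g x) (map (fun u => (u.1, act g u.2)) l) (act g y).
Proof.
elim: l x => [x /= -> //|u l IH x [xu /IH h]] /=.
by rewrite !ends_equi -xu.
Qed.

(** The size bound preserves shortest walks, and the last clause keeps a walk inside the image of a
    graph when it is reduced. *)
Lemma gwalk_reduce x l y : gwalk x l y ->
  exists k, [/\ gwalk x k y, nobt k, (size k <= size l)%N &
                forall u, List.In u k -> List.In u l].
Proof.
elim: l x => [x /= ->|u l IH x [xu /IH [k [hk nk sk kl]]]]; first by exists [::].
have dflt : nobt (u :: k) -> exists k', [/\ gwalk x k' y, nobt k',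
    (size k' <= size (u :: l))%N & forall u0, List.In u0 k' -> List.In u0 (u :: l)].
  move=> nk'; exists (u :: k); split=> //.
  by move=> v [->|/kl]; [left|right].
case: k hk nk sk kl dflt => [|v k] hk nk sk kl dflt; first exact: dflt.
case: (pselect (v = flip u)) => vu; last by apply: dflt.
exists k; split.
- by move: hk => /= []; rewrite vu /= negbK -xu.
- exact: nobt_cons nk.
- by rewrite /= (leq_trans (leqnSn _)) // (leq_trans sk).
- by move=> w kw; right; apply: kl; right.
Qed.

End Walks.

Definition gconn (X : ggraph) := forall x y : gV X, exists l, gwalk x l y.
Definition gacyclic (X : ggraph) :=
  forall (x : gV X) l, gwalk x l x -> nobt l -> l = [::].

(** From the first step where they differ, one walk reversed and followed by the other is a closed
    walk without backtracking. *)
Lemma gwalk_unique (X : ggraph) : gacyclic X -> forall (x y : gV X) p q,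
  gwalk x p y -> gwalk x q y -> nobt p -> nobt q -> p = q.
Proof.
move=> aX x y p; elim: p x => [|s p IH] x q.
  by move=> /= -> hq _ nq; rewrite (aX y q).
case: q => [|t q] hp hq np nq.
  by rewrite -hq in hp; apply: (aX x).
case: (pselect (t = s)) => ts.
  subst t; congr (_ :: _); exact: IH hp.2 hq.2 (nobt_cons np) (nobt_cons nq).
have := gwalk_cat (gwalk_rev hp) hq.
rewrite /flip_rev /= rev_cons -cats1 -catA /= => h.
have n : nobt (rev [seq flip i | i <- p] ++ [:: flip s, t & q]).
  apply: nobt_cat => //; last by rewrite flipK.
  by have := nobt_rev np; rewrite /flip_rev /= rev_cons -cats1.
by have := aX _ _ h n; case: (rev _).
Qed.

Record gmor (X Y : ggraph) := GMor {
  mV : gV X -> gV Y;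
  mE : gE X -> gE Y;
  mV_equi : equivariant mV;
  mE_equi : equivariant mE;
  mends : forall b e, mV (ends b e) = ends b (mE e) }.

Definition mapw X Y (m : gmor X Y) := map (fun u : bool * gE X => (u.1, mE m u.2)).

Lemma gwalk_mor X Y (m : gmor X Y) x l y : gwalk x l y ->
  gwalk (mV m x) (mapw m l) (mV m y).
Proof.
elim: l x => [x /= -> //|u l IH x [xu /IH h]] /=.
by rewrite -!mends -xu.
Qed.

Lemma stab_ends (X : ggraph) b (e : gE X) g : stab e g -> stab (ends b e) g.
Proof. exact: (stab_equi (@ends_equi X b)). Qed.

(* [N] is the set of non-root vertices. A vertex flows if it can be pushed to a
   root along edges whose stabilizer equals that of their initial vertex: the
   edges of a compressing forest form such a flow. *)
Inductive flows (X : ggraph) (N : gV X -> Prop) : gV X -> Prop :=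
 | flow_root x : ~ N x -> flows N x
 | flow_step b e : (forall g, stab (ends b e) g -> stab e g) ->
     flows N (ends (~~ b) e) -> flows N (ends b e).

Lemma flows_act (X : ggraph) (N : gV X -> Prop) g x : ginvariant N ->
  flows N x -> flows N (act g x).
Proof.
move=> iN; elim=> {x} [x nx|b e be _ IH].
  by apply: flow_root; rewrite ginvariantE.
rewrite -ends_equi; apply: flow_step; last by rewrite ends_equi.
by move=> h; rewrite ends_equi !stab_act; apply: be.
Qed.

(** * Flows after identifying two vertices *)

Section MergeFlow.
Variables (X X' : ggraph) (m : gmor X X') (a c : gV X).
Hypothesis mm : is_merge (mV m) a c.
Variable N : gV X -> Prop.
Hypothesis iN : ginvariant N.
Variable flag : Prop.
Hypothesis flagN : flag -> N a /\ N c.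
Hypothesis finE : forall e : gE X, fin (stab e).

(** [flag] decides whether the merged orbit is non-root; the other orbits keep their status. The
    hypothesis [flagN] guarantees that no root is turned into a non-root. *)
Definition mergeN (u : gV X') :=
  (orb (mV m a) u /\ flag) \/ (~ orb (mV m a) u /\ exists x, mV m x = u /\ N x).

Lemma merge_orb x : orb (mV m a) (mV m x) <-> orb a x \/ orb c x.
Proof.
have pe := merge_equi mm.
split=> [[g]|[|]]; last 2 first.
- exact: orb_equi.
- by rewrite (merge_eq mm); apply: orb_equi.
by rewrite -pe => /(merge_sep mm) [->|[]//]; left; apply: orb_act.
Qed.

Lemma mergeNE x : mergeN (mV m x) <->
  (orb (mV m a) (mV m x) /\ flag) \/ (~ orb (mV m a) (mV m x) /\ N x).
Proof.
split=> -[|[no]]; [by left| |by left|].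
  move=> [y [/(merge_sep mm) [->|[_ /merge_orb]]//]]; by right.
by move=> Nx; right; split=> //; exists x.
Qed.

Lemma invariant_mergeN : ginvariant mergeN.
Proof.
move=> g u; case: (merge_surj mm u) => x <-; rewrite -mV_equi !mergeNE.
by rewrite mV_equi orb_actr (ginvariantE _ _ iN).
Qed.

Lemma mergeN_root x : ~ N x -> ~ mergeN (mV m x).
Proof.
move=> nN; rewrite mergeNE => -[[/merge_orb o /flagN [Na Nc]]|[_ //]].
by apply: nN; case: o => -[g ->]; apply: iN.
Qed.

Lemma merge_stab_out x g : ~ orb a x -> ~ orb c x ->
  stab (mV m x) g -> stab x g.
Proof.
move=> nax ncx; rewrite /stab -mV_equi => /(merge_sep mm) [//|[_]].
by case.
Qed.

Lemma merge_flow_step b e : (forall g, stab (mV m (ends b e)) g -> stab (ends b e) g) ->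
  (forall g, stab (ends b e) g -> stab e g) ->
  flows mergeN (mV m (ends (~~ b) e)) -> flows mergeN (mV m (ends b e)).
Proof.
move=> h1 h2; rewrite !mends => fl; apply: flow_step => // g.
by rewrite -mends => /h1 /h2; apply: stab_equi; apply: mE_equi.
Qed.

(** An old flow survives until it enters the merged orbit, since stabilizers do not grow outside
    that orbit; from there the flow assumed for [mV m a] takes over. *)
Lemma merge_flows : (forall x, flows N x) -> flows mergeN (mV m a) ->
  forall u, flows mergeN u.
Proof.
move=> flN fla u; case: (merge_surj mm u) => x <-.
elim: (flN x) => {x} [x nx|b e be _ IH]; first exact/flow_root/mergeN_root.
have out x : orb a x \/ orb c x -> flows mergeN (mV m x).
  move=> /merge_orb [g ->]; apply: flows_act => //; exact: invariant_mergeN.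
case: (pselect (orb a (ends b e))) => oa; first by apply: out; left.
case: (pselect (orb c (ends b e))) => oc; first by apply: out; right.
by apply: merge_flow_step => // g; apply: merge_stab_out.
Qed.

(* Follow the flow of [x] up to its last visit of the merged orbit. *)
Lemma merge_last_visit x : flows N x -> flows mergeN (mV m x) \/
  exists b e, [/\ orb a (ends b e) \/ orb c (ends b e),
    forall g, stab (ends b e) g -> stab e g,
    flows mergeN (mV m (ends (~~ b) e)) &
    (wt (stab (ends b e)) <= wt (stab x))%R].
Proof.
elim=> {x} [x nx|b e be _ IH]; first by left; apply/flow_root/mergeN_root.
(* Stabilizers can only grow along a flow, so weights decrease. *)
have le : (wt (stab (ends (~~ b) e)) <= wt (stab (ends b e)))%R.
  apply: wt_sub; first exact: subgroup_stab.
    by move=> g /be; apply: stab_ends.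
  exact: has_card_sub be (finE e).
case: IH => [IH|[b' [e' [h1 h2 h3 h4]]]]; last first.
  by right; exists b', e'; split=> //; apply: le_trans h4 le.
case: (pselect (orb a (ends b e) \/ orb c (ends b e))) => o.
  by right; exists b, e; split.
left; apply: merge_flow_step => // g.
by apply: merge_stab_out => h; apply: o; [left|right].
Qed.

(** If the merge does not enlarge the stabilizer of one of the merged points, an exit edge of that
    point is still an exit edge of the merged vertex. *)
Lemma merge_flow_from b e d : mV m d = mV m a ->
  (forall g, stab (mV m a) g -> stab d g) ->
  orb d (ends b e) -> (forall g, stab (ends b e) g -> stab e g) ->
  flows mergeN (mV m (ends (~~ b) e)) -> flows mergeN (mV m a).
Proof.
move=> da ad [k ke] be fl.
have : flows mergeN (mV m (ends b e)).
  apply: merge_flow_step => // g; rewrite ke mV_equi !stab_act da; exact: ad.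
rewrite ke mV_equi da => /(flows_act k^! invariant_mergeN).
by rewrite actK.
Qed.

End MergeFlow.
End GGraph.

(** * Folding *)

Section Fold.
Variables (G : Type) (grp : group_on G).
Local Notation "x ** y" := (gmul grp x y) (at level 40, left associativity).
Local Notation "x ^!" := (ginv grp x) (at level 1, format "x ^!").
Local Notation stab := (@stab G grp _).
Local Notation orb := (@orb G grp _).
Local Notation ggraph := (ggraph grp).

(** At the end [b] the two edges already agree, and at the other end their images are identified;
    hence both end maps descend to the merged edges by the universal property. *)
Lemma fold_graph (X Y : ggraph) (m : gmor X Y) b (e f : gE X) :
  ends b e = ends b f -> mE m e = mE m f ->
  exists (X' : ggraph) (p : gmor X X') (m' : gmor X' Y),
    is_merge (mV p) (ends (~~ b) e) (ends (~~ b) f) /\ is_merge (mE p) e f.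
Proof.
move=> vef mef.
have [V' [pV [mV' uV]]] := merge_exists (ends (~~ b) e) (ends (~~ b) f).
have [E' [pE [mE' uE]]] := merge_exists e f.
have pVe := merge_equi mV'; have pEe := merge_equi mE'.
have [phi [phie phiE]] := uV _ _ (@mV_equi _ _ _ _ m)
  ltac:(by rewrite !mends mef).
have [psi [psie psiE]] := uE _ _ (@mE_equi _ _ _ _ m) mef.
have exEnd b' : exists h : E' -> V', equivariant h /\ forall x, h (pE x) = pV (ends b' x).
  apply: uE; first by move=> g x; rewrite ends_equi pVe.
  have [->|->] : b' = b \/ b' = ~~ b by clear; case: b b' => -[]; tauto.
    by rewrite vef.
  exact: merge_eq mV'.
have [ht [hte htE]] := exEnd true; have [hf [hfe hfE]] := exEnd false.
have endse (b' : bool) : equivariant (if b' then ht else hf) by case: b'.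
pose X' : ggraph := @GGraph _ _ V' E' (fun b' => if b' then ht else hf) endse.
have pends b' x : pV (ends b' x) = (if b' then ht else hf) (pE x).
  by case: b'; rewrite ?htE ?hfE.
have mends' b' y : phi ((if b' then ht else hf) y) = ends b' (psi y).
  have [x <-] := merge_surj mE' y.
  by rewrite -pends phiE psiE mends.
exists X', (@GMor _ _ X X' pV pE pVe pEe pends).
by exists (@GMor _ _ X' Y phi psi phie psie mends').
Qed.

Lemma merge_graph (X Y : ggraph) (m : gmor X Y) (a c : gV X) :
  mV m a = mV m c ->
  exists (X' : ggraph) (p : gmor X X') (m' : gmor X' Y),
    [/\ is_merge (mV p) a c, injective (mE p), forall y, exists x, mE p x = y &
        forall x, mV m' (mV p x) = mV m x].
Proof.
move=> mac.
have [V' [pV [mV' uV]]] := merge_exists a c.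
have pVe := merge_equi mV'.
have [phi [phie phiE]] := uV _ _ (@mV_equi _ _ _ _ m) mac.
have endse b' : equivariant (pV \o ends b') by move=> g x /=; rewrite ends_equi pVe.
pose X' : ggraph := @GGraph _ _ V' (gE X) (fun b' => pV \o ends b') endse.
have pEe : equivariant (fun x : gE X => x) by [].
exists X', (@GMor _ _ X X' pV (fun x => x) pVe pEe (fun _ _ => erefl)).
have mends' b' (y : gE X) : phi ((pV \o ends b') y) = ends b' (mE m y).
  by rewrite /= phiE mends.
exists (@GMor _ _ X' Y phi (mE m) phie (@mE_equi _ _ _ _ m) mends').
by split=> // y; exists y.
Qed.

(** * Exits from the vertex created by a fold *)

Section FoldFlow.
Variables (X X' : ggraph) (p : gmor X X') (b : bool) (e f : gE X).
Variables (a c v : gV X).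
Hypotheses (ea : ends (~~ b) e = a) (fc : ends (~~ b) f = c).
Hypotheses (ev : ends b e = v) (fv : ends b f = v).
Hypothesis mm : is_merge (mV p) a c.
Hypothesis me : is_merge (mE p) e f.
Variable N : gV X -> Prop.
Hypothesis iN : ginvariant N.
Hypothesis flN : forall x, flows N x.
Variable flag : Prop.
Hypothesis flagN : flag -> N a /\ N c.
Hypothesis finE : forall e : gE X, fin (stab e).

Let sub_ea g : stab e g -> stab a g. Proof. by rewrite -ea; apply: stab_ends. Qed.
Let sub_fc g : stab f g -> stab c g. Proof. by rewrite -fc; apply: stab_ends. Qed.
Let sub_ev g : stab e g -> stab v g. Proof. by rewrite -ev; apply: stab_ends. Qed.
Let sub_fv g : stab f g -> stab v g. Proof. by rewrite -fv; apply: stab_ends. Qed.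
Let sub_eH g : stab e g -> stab (mE p e) g.
Proof. by apply: stab_equi; apply: mE_equi. Qed.
Let sub_fH g : stab f g -> stab (mE p e) g.
Proof. by rewrite (merge_eq me); apply: stab_equi; apply: mE_equi. Qed.

Lemma fold_flow_back : (forall g, stab (mV p a) g -> stab (mE p e) g) ->
  flows (mergeN p a N flag) (mV p v) -> flows (mergeN p a N flag) (mV p a).
Proof.
move=> KH; rewrite -{1}ev -ea !mends => fl; apply: flow_step; last by rewrite negbK.
by move=> g; rewrite -mends ea; apply: KH.
Qed.

(** The stabilizer of [a] lies in that of [f], hence in that of [c], so the merged vertex keeps the
    stabilizer of [c] and can leave along the old flow of [c]. *)
Lemma fold_flow_mixed : ~ orb a c ->
  (forall g, stab a g -> stab e g) -> ~ (forall g, stab c g -> stab f g) ->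
  (forall g, stab (mE p e) g -> stab f g) ->
  flows (mergeN p a N flag) (mV p a) /\ (forall g, stab (mV p a) g -> stab c g).
Proof.
move=> nac ae ncf Hf.
have ac g : stab a g -> stab c g by move=> /ae /sub_eH /Hf /sub_fc.
have Kc : forall g, stab (mV p a) g -> stab c g.
  apply: (merge_stab mm) => //; first exact: subgroup_stab.
  by move=> g gac; case: nac; exists g.
split=> //.
case: (merge_last_visit mm iN flagN finE (flN c)).
  by rewrite (merge_eq mm).
move=> [b' [e' [o be fl le]]]; case: o => o; last first.
  apply: (merge_flow_from mm iN (d := c) _ Kc o be fl).
  by rewrite (merge_eq mm).
(* A last visit to the orbit of [a] would make the weight of [a] at most that of [c]; then their
   stabilizers agree and that of [c] fixes [f], contrary to assumption. *)
case: ncf => g cg; apply/Hf/sub_eH/ae.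
apply: (wt_sub_eq (subgroup_stab _) (subgroup_stab _) ac) cg.
  exact: has_card_sub ae (finE e).
by rewrite -(wt_stab_orb o).
Qed.

(** Comparing weights shows that [v], [h] and [d] have the same stabilizer. It contains those of [e]
    and [f], hence that of the folded edge, so the merge does not enlarge the stabilizer of [d] and
    its exit edge can be reused. *)
Lemma fold_flow_visit d h : (d = a \/ d = c) -> (h = e \/ h = f) ->
  (forall g, stab h g -> stab d g) ->
  (forall g, stab d g -> stab h g) ->
  (forall g, stab (mV p a) g -> stab (mE p e) g) ->
  (wt (stab d) <= wt (stab v))%R ->
  forall b' e', orb d (ends b' e') -> (forall g, stab (ends b' e') g -> stab e' g) ->
  flows (mergeN p a N flag) (mV p (ends (~~ b') e')) ->
  ~ orb e f -> flows (mergeN p a N flag) (mV p a).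
Proof.
move=> dac hef hd dh KH le b' e' o be fl nef.
have sub_hv g : stab h g -> stab v g by case: hef => ->; [apply: sub_ev|apply: sub_fv].
have dhE : stab d = stab h by apply: pred_ext => g; split; [apply: dh|apply: hd].
have vh g : stab v g -> stab h g.
  apply: (wt_sub_eq (subgroup_stab _) (subgroup_stab _) sub_hv (finE h)).
  by rewrite -dhE.
have Hh : forall g, stab (mE p e) g -> stab h g.
  apply: (merge_stab me); first exact: subgroup_stab.
  - by move=> g /sub_ev /vh.
  - by move=> g /sub_fv /vh.
  - by move=> g gef; case: nef; exists g.
apply: (merge_flow_from mm iN (d := d) _ _ o be fl).
  by case: dac => ->; rewrite ?(merge_eq mm).
by move=> g /KH /Hh /hd.
Qed.

(** The stabilizer of the merged vertex is generated by the two old stabilizers and the elements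
    taking [a] to [c]; all of them fix the folded edge. *)
Lemma fold_stab_sub : (forall g, stab a g -> stab e g) ->
  (forall g, stab c g -> stab f g) -> (forall g, act g a = c -> act g e = f) ->
  forall g, stab (mV p a) g -> stab (mE p e) g.
Proof.
move=> ae cf acef; apply: (merge_stab mm); first exact: subgroup_stab.
- by move=> g /ae /sub_eH.
- by move=> g /cf /sub_fH.
- by move=> g /acef gef; rewrite /stab -mE_equi gef -(merge_eq me).
Qed.

End FoldFlow.

(** The first choice is to make the merged orbit a root ([useF]), where only the inequality is at
    stake. When the inequality could fail, [flag] is true, the stabilizer of the merged vertex is
    that of the folded edge or of one of the old ends, the two sides balance, and an exit must be
    found. *)
Lemma fold_flag (X X' : ggraph) (p : gmor X X') b (e f : gE X) (N : gV X -> Prop) :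
  let a := ends (~~ b) e in let c := ends (~~ b) f in
  ends b e = ends b f -> e <> f ->
  is_merge (mV p) a c -> is_merge (mE p) e f ->
  ginvariant N -> (forall x, flows N x) -> (forall e : gE X, fin (stab e)) ->
  exists flag : Prop, [/\ flag -> N a /\ N c,
    flows (mergeN p a N flag) (mV p a) &
    (wt (stab (mE p e)) - wt (stab e) - ind (~ orb e f) (wt (stab f)) <=
     - ind (N a) (wt (stab a)) - ind (~ orb a c /\ N c) (wt (stab c))
     + ind flag (wt (stab (mV p a))))%R].
Proof.
move=> a c vef ef mm me iN flN finE.
have sub_ea g : stab e g -> stab a g by apply: stab_ends.
have sub_fc g : stab f g -> stab c g by apply: stab_ends.
have sub_eH g : stab e g -> stab (mE p e) g by apply: stab_equi; apply: mE_equi.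
have sub_fH g : stab f g -> stab (mE p e) g.
  by rewrite (merge_eq me); apply: stab_equi; apply: mE_equi.
have le_He : (wt (stab (mE p e)) <= wt (stab e))%R.
  by apply: wt_sub => //; apply: subgroup_stab.
have le_Hf : (wt (stab (mE p e)) <= wt (stab f))%R.
  by apply: wt_sub => //; apply: subgroup_stab.
have le_ae : (wt (stab a) <= wt (stab e))%R.
  by apply: wt_sub => //; apply: subgroup_stab.
have le_cf : (wt (stab c) <= wt (stab f))%R.
  by apply: wt_sub => //; apply: subgroup_stab.
have e0 := wt_ge0 (stab e); have f0 := wt_ge0 (stab f).
have a0 := wt_ge0 (stab a); have c0 := wt_ge0 (stab c).
have flF : flows (mergeN p a N False) (mV p a).
  apply: flow_root; rewrite (mergeNE mm); case=> [[]//|[[]]]; exact: orb_refl.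
have useF : (wt (stab (mE p e)) - wt (stab e) - ind (~ orb e f) (wt (stab f)) <=
     - ind (N a) (wt (stab a)) - ind (~ orb a c /\ N c) (wt (stab c)))%R ->
  exists flag : Prop, [/\ flag -> N a /\ N c,
    flows (mergeN p a N flag) (mV p a) &
    (wt (stab (mE p e)) - wt (stab e) - ind (~ orb e f) (wt (stab f)) <=
     - ind (N a) (wt (stab a)) - ind (~ orb a c /\ N c) (wt (stab c))
     + ind flag (wt (stab (mV p a))))%R].
  by move=> h; exists False; split=> //; rewrite [ind False _]indF // addr0.
have wt_ext (P Q : G -> Prop) : (forall g, P g -> Q g) -> (forall g, Q g -> P g) -> wt P = wt Q.
  by move=> PQ QP; congr wt; apply: pred_ext => g; split; [apply: PQ|apply: QP].
case: (pselect (orb e f)) => [oef|nef].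
  have oac : orb a c by apply: (orb_equi (@ends_equi _ _ X (~~ b))).
  have i1 : ind (~ orb e f) (wt (stab f)) = 0%R by apply: indF.
  have i2 : ind (~ orb a c /\ N c) (wt (stab c)) = 0%R by apply: indF; case.
  rewrite i1 i2 in useF *.
  (* The element carrying [e] to [f] fixes the folded edge but not [e], so folding within an orbit
     at least halves the edge weight. *)
  have nHe : ~ (forall g, stab (mE p e) g -> stab e g).
    case: oef => k fk h; apply: ef; rewrite fk; symmetry; apply: h.
    by rewrite /stab -mE_equi -fk (merge_eq me).
  have le2_H := wt_half (subgroup_stab e) (subgroup_stab (mE p e)) sub_eH (finE e) nHe.
  case: (pselect (N a)) => Na; last by apply: useF; rewrite indF //; lra.
  rewrite indT // in useF *.
  case: (pselect (forall g, stab a g -> stab e g)) => ae; last first.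
    have le2 := wt_half (subgroup_stab e) (subgroup_stab a) sub_ea (finE e) ae.
    by apply: useF; lra.
  have Nc : N c by case: oac => k ->; apply: iN.
  have KH : forall g, stab (mV p a) g -> stab (mE p e) g.
    case: oef => k fk; have ck : c = act k a by rewrite /c fk ends_equi.
    apply: (fold_stab_sub mm me) => //.
      by move=> g; rewrite ck fk !stab_act; apply: ae.
    move=> g gac; have := ae (k^! ** g); rewrite /stab !actM gac ck actK.
    by move=> /(_ erefl) h; apply: (@act_inj _ _ _ k^!); rewrite -actM h fk actK.
  exists True; split=> //; last first.
    rewrite [ind True _]indT //.
    have -> : stab (mV p a) = stab (mE p e).
      apply: pred_ext => g; split; first exact: KH.
      by rewrite /a mends; apply: stab_ends.
    by lra.
  apply: (fold_flow_back (b := b) (v := ends b e) _ _ KH) => //.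
  case: (merge_last_visit (flag := True) mm iN _ finE (flN (ends b e))) => //.
  move=> [b' [e' [o be fl le]]].
  (* The flow of [v] cannot visit the merged orbit: weights would make the stabilizers of [v] and
     [e] equal, but [k] fixes [v] and moves [e] to [f]. *)
  case: oef => k fk; case: ef; rewrite fk; symmetry.
  have sub_ev g : stab e g -> stab (ends b e) g by apply: stab_ends.
  apply: (wt_sub_eq (subgroup_stab _) (subgroup_stab _) sub_ev (finE e)).
    rewrite -(wt_ext _ _ ae sub_ea); congr (_ <= _)%R: le.
    case: o => o; first exact: wt_stab_orb.
    by rewrite (wt_stab_orb o); apply: wt_stab_orb.
  by rewrite /stab -ends_equi -fk.
have i1 : ind (~ orb e f) (wt (stab f)) = wt (stab f) by apply: indT.
rewrite i1 in useF *.
case: (pselect (orb a c)) => [oac|nac].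
  apply: useF; rewrite [ind (~ _ /\ _) _]indF; last by case.
  have : (ind (N a) (wt (stab a)) <= wt (stab a))%R.
    by rewrite /ind; case: pselect.
  by lra.
have i2 : ind (~ orb a c /\ N c) (wt (stab c)) = ind (N c) (wt (stab c)).
  by congr ind; apply: propositional_extensionality; tauto.
rewrite i2 in useF *.
case: (pselect (N a)) => Na; last first.
  apply: useF; rewrite [ind (N a) _]indF //.
  have : (ind (N c) (wt (stab c)) <= wt (stab c))%R.
    by rewrite /ind; case: pselect.
  by lra.
case: (pselect (N c)) => Nc; last first.
  by apply: useF; rewrite [ind (N c) _]indF // [ind (N a) _]indT //; lra.
rewrite [ind (N c) _]indT // [ind (N a) _]indT // in useF *.
have half_a : ~ (forall g, stab a g -> stab e g) -> (2 * wt (stab a) <= wt (stab e))%R.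
  exact: (wt_half (subgroup_stab e) (subgroup_stab a) sub_ea (finE e)).
have half_c : ~ (forall g, stab c g -> stab f g) -> (2 * wt (stab c) <= wt (stab f))%R.
  exact: (wt_half (subgroup_stab f) (subgroup_stab c) sub_fc (finE f)).
have half_He : ~ (forall g, stab (mE p e) g -> stab e g) ->
    (2 * wt (stab (mE p e)) <= wt (stab e))%R.
  exact: (wt_half (subgroup_stab e) (subgroup_stab _) sub_eH (finE e)).
have half_Hf : ~ (forall g, stab (mE p e) g -> stab f g) ->
    (2 * wt (stab (mE p e)) <= wt (stab f))%R.
  exact: (wt_half (subgroup_stab f) (subgroup_stab _) sub_fH (finE f)).
case: (pselect (forall g, stab a g -> stab e g)) => ae;
  case: (pselect (forall g, stab c g -> stab f g)) => cf; last 1 first.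
(* Both inclusions are proper: [a] and [c] together weigh at most half of [e] and [f], and the
   folded edge weighs at most the other half. *)
- by have := half_a ae; have := half_c cf => ? ?; apply: useF; lra.
(* Both are equalities: the merged vertex has the stabilizer of the folded edge and goes back along
   it to [v], unless the flow of [v] itself meets the merged orbit. *)
- have KH : forall g, stab (mV p a) g -> stab (mE p e) g.
    apply: (fold_stab_sub mm me) => // g gac.
    by case: nac; exists g.
  exists True; split=> //; last first.
    rewrite [ind True _]indT //.
    have -> : stab (mV p a) = stab (mE p e).
      apply: pred_ext => g; split; first exact: KH.
      by rewrite /a mends; apply: stab_ends.
    by lra.
  case: (merge_last_visit (flag := True) mm iN _ finE (flN (ends b e))) => //.
    exact: (fold_flow_back (b := b) (v := ends b e) _ _ KH).
  move=> [b' [e' [[o|o] be fl le]]].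
    apply: (fold_flow_visit (b := b) (v := ends b e) (d := a) (h := e) _ _ mm me iN finE
             _ _ _ _ _ _ o) => //; try by left.
    by rewrite -(wt_stab_orb o).
  apply: (fold_flow_visit (b := b) (v := ends b e) (d := c) (h := f) _ _ mm me iN finE
             _ _ _ _ _ _ o) => //; try by right.
  by rewrite -(wt_stab_orb o).
(* Only the inclusion at [c] is proper. If folding enlarges the stabilizer of [f], the two halvings
   of the weight of [f] pay for a root; otherwise [fold_flow_mixed] applies. *)
- case: (pselect (forall g, stab (mE p e) g -> stab f g)) => Hf; last first.
    by have := half_Hf Hf; have := half_c cf => ? ?; apply: useF; lra.
  exists True.
  have [fl Kc] := fold_flow_mixed (b := b) erefl mm iN flN (fun _ : True => conj Na Nc)
    finE nac ae cf Hf.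
  split=> //; rewrite [ind True _]indT //.
  have -> : wt (stab (mE p e)) = wt (stab f) by apply: wt_ext.
  have -> : wt (stab (mV p a)) = wt (stab c); last by lra.
  apply: wt_ext => // g; rewrite (merge_eq mm); apply: stab_equi; exact: mV_equi.
- case: (pselect (forall g, stab (mE p e) g -> stab e g)) => He; last first.
    by have := half_He He; have := half_a ae => ? ?; apply: useF; lra.
  exists True.
  have nca : ~ orb c a by move/orb_sym.
  have Hfe : forall g, stab (mE p f) g -> stab e g by rewrite -(merge_eq me).
  have [fl Ka] := fold_flow_mixed (b := b) erefl (is_merge_sym mm) iN flN
    (fun _ : True => conj Nc Na) finE nca cf ae Hfe.
  have mNE : mergeN p c N True = mergeN p a N True by rewrite /mergeN (merge_eq mm).
  rewrite mNE -(merge_eq mm) in fl; rewrite -(merge_eq mm) in Ka.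
  split=> //; rewrite [ind True _]indT //.
  have -> : wt (stab (mE p e)) = wt (stab e) by apply: wt_ext.
  have -> : wt (stab (mV p a)) = wt (stab a); last by lra.
  by apply: wt_ext => // g; apply: stab_equi; exact: mV_equi.
Qed.

Lemma fold_step (X Y : ggraph) (m : gmor X Y) b (e f : gE X) (N : gV X -> Prop) sE sN :
  (forall e : gE Y, fin (stab e)) ->
  ends b e = ends b f -> mE m e = mE m f -> e <> f ->
  ginvariant N -> (forall x, flows N x) ->
  osum (fun _ : gE X => True) sE -> osum N sN ->
  exists (X' : ggraph) (p : gmor X X') (m' : gmor X' Y) (N' : gV X' -> Prop) sE' sN',
    [/\ forall y, exists x, mV p x = y, ginvariant N', forall x, flows N' x,
        osum (fun _ : gE X' => True) sE' & osum N' sN'] /\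
    (sE' < sE)%R /\ (sE' - sN' <= sE - sN)%R.
Proof.
move=> finY vef mef ef iN flN hE hN.
have finE (x : gE X) : fin (stab x).
  by apply: has_card_sub (finY (mE m x)) => g; apply: stab_equi; apply: mE_equi.
have [X' [p [m' [mm me]]]] := fold_graph vef mef.
have [flag [flagN fl le]] := fold_flag vef ef mm me iN flN finE.
have hN' := osum_merge mm iN (@mergeNE _ _ _ _ _ _ _ mm N flag) hN.
have hE' := osum_merge (P' := fun _ => True) (flag := True) me _ _ hE.
exists X', p, m', (mergeN p (ends (~~ b) e) N flag).
set sE' := (_ + ind True _)%R in hE'.
set sN' := (_ + ind flag _)%R in hN'.
exists sE', sN'; split; [split=> //|].
- exact: merge_surj mm.
- exact: (invariant_mergeN mm iN).
- exact: (merge_flows mm iN flagN flN fl).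
- by apply: hE' => // x; split=> // _; case: (pselect (orb (mE p e) (mE p x))); tauto.
rewrite /sE' /sN' ![ind True _]indT //.
have -> : ind (~ orb e f /\ True) (wt (stab f)) = ind (~ orb e f) (wt (stab f)).
  by congr ind; apply: propositional_extensionality; tauto.
split; last by lra.
have e0 := wt_gt0 (subgroup_stab e) (finE e).
have f0 := wt_gt0 (subgroup_stab f) (finE f).
have sub_eH g : stab e g -> stab (mE p e) g by apply: stab_equi; apply: mE_equi.
have le_He : (wt (stab (mE p e)) <= wt (stab e))%R.
  by apply: wt_sub => //; apply: subgroup_stab.
(* Strict decrease: distinct orbits lose at least the weight of one edge, and a single orbit has its
   weight at least halved. *)
case: (pselect (orb e f)) => [oef|nef]; last by rewrite [ind _ _]indT //; lra.
rewrite [ind _ _]indF //.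
have nHe : ~ (forall g, stab (mE p e) g -> stab e g).
  case: oef => k fk h; apply: ef; rewrite fk; symmetry; apply: h.
  by rewrite /stab -mE_equi -fk (merge_eq me).
have := wt_half (subgroup_stab e) (subgroup_stab (mE p e)) sub_eH (finE e) nHe.
by lra.
Qed.

End Fold.

(** * Graphs immersed in a tree *)

Section Immersion.
Variables (G : Type) (grp : group_on G).
Local Notation stab := (@stab G grp _).
Local Notation orb := (@orb G grp _).
Local Notation ggraph := (ggraph grp).

Definition immersed (X Y : ggraph) (m : gmor X Y) :=
  forall b e f, ends b e = ends b f -> mE m e = mE m f -> e = f.

Definition greduced (Y : ggraph) := forall b (s : gE Y),
  (forall g, stab (ends b s) g -> stab s g) -> orb (ends b s) (ends (~~ b) s).

Variables (X Y : ggraph) (m : gmor X Y).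
Hypotheses (im : immersed m) (cX : gconn X) (cY : gconn Y) (aY : gacyclic Y).

Lemma immersed_nobt x l y : gwalk x l y -> nobt l -> nobt (mapw m l).
Proof.
elim: l x => [//|u [//|v l] IH x [xu h] [vu nl]].
split; last exact: IH h nl.
move=> [e1 e2]; apply: vu; case: h => uv _.
rewrite [v]surjective_pairing e1 /flip; congr (_, _).
by apply: (im (b := ~~ u.1)) e2; rewrite uv e1.
Qed.

(** A walk without backtracking from [x] to [y] maps to a closed walk without backtracking in the
    tree, so it is empty. *)
Lemma immersed_injV x y : mV m x = mV m y -> x = y.
Proof.
have [l /gwalk_reduce [k [hk nk _ _]]] := cX x y => xy.
have hm := gwalk_mor m hk; rewrite -xy in hm.
have := aY hm (immersed_nobt hk nk).
by case: k hk {nk hm} => [//|].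
Qed.

Lemma immersed_injE e f : mE m e = mE m f -> e = f.
Proof.
move=> ef; apply: (im (b := true)) => //.
by apply: immersed_injV; rewrite !mends ef.
Qed.

Lemma image_walk x y : exists k, [/\ gwalk (mV m x) k (mV m y), nobt k &
  forall u, List.In u k -> exists e, u.2 = mE m e].
Proof.
have [l /(gwalk_mor m) /gwalk_reduce [k [hk nk _ kl]]] := cX x y.
exists k; split=> // u /kl /List.in_map_iff [w [<- _]].
by exists w.2.
Qed.

Hypothesis rY : greduced Y.
Hypothesis neX : exists x : gV X, True.

(* A vertex outside the image is fixed only by elements that fix the first edge
   on its shortest path to the image; as [Y] is reduced, that edge leads to a
   translate of the vertex, which is closer to the image: absurd. *)
Lemma image_surjV u : exists x, mV m x = u.
Proof.
apply: Classical_Prop.NNPP => nu.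
pose D v n := exists l x, size l = n /\ gwalk v l (mV m x).
have Dact g v n : D v n -> D (act g v) n.
  move=> [l [x [<- h]]]; exists (map (fun u => (u.1, act g u.2)) l), (act g x).
  by rewrite size_map mV_equi; split=> //; apply: gwalk_act.
have [x0 _] := neX.
have [n [Dn minn]] : exists n, D u n /\ forall k, D u k -> (n <= k)%N.
  have [l hl] := cY u (mV m x0).
  have : D u (size l) by exists l, x0.
  move: (size l); elim/ltn_ind => k IH Dk.
  case: (pselect (exists j, (j < k)%N /\ D u j)) => [[j [jk Dj]]|nj].
    exact: IH jk Dj.
  by exists k; split=> // j Dj; rewrite leqNgt; apply/negP => jk; apply: nj; exists j.
have [l0 [x [sl0 /gwalk_reduce [l [hl nl sl' _]]]]] := Dn.
have sl : size l = n.
  by apply/eqP; rewrite eqn_leq -{1}sl0 sl' /=; apply: minn; exists l, x.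
(* No edge of a shortest walk to the image lies in the image, for the walk could stop before it. *)
have min_out w (k : seq (bool * gE Y)) : gwalk w k (mV m x) ->
    (forall j, D w j -> (size k <= j)%N) ->
    forall v, List.In v k -> ~ exists e, v.2 = mE m e.
  elim: k w => [//|t k IH w [wt hk] mk v [<-|kv]].
    move=> [e te].
    suff : (size (t :: k) <= 0)%N by [].
    by apply: mk; exists [::], (ends t.1 e); split; rewrite //= wt te mends.
  apply: IH hk _ v kv => j [k' [y [sk' hk']]].
  rewrite -ltnS; apply: (mk j.+1); exists (t :: k'), y.
  by split; rewrite /= ?sk'.
case: l sl {sl'} hl nl => [|[b s] l] sl hl nl; first by apply: nu; exists x.
have lmin j : D u j -> (size ((b, s) :: l) <= j)%N by rewrite sl; apply: minn.
have lout := min_out _ _ hl lmin.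
have us : u = ends b s by case: hl.
(* The translate by [g] of the shortest walk, and the walk itself prolonged inside the image, have
   the same ends and no backtracking; by uniqueness their first edges agree. *)
have fixs g : stab (ends b s) g -> stab s g.
  rewrite -us => gu.
  have [w [hw nw wim]] := image_walk x (act g x).
  have h1 := gwalk_cat hl hw.
  have h2 := gwalk_act g hl; rewrite gu -mV_equi in h2.
  have n1 : nobt (((b, s) :: l) ++ w).
    apply: nobt_catl => // v1 v2 hv1 /wim [e ve] v21; apply: (lout v1 hv1).
    by exists e; rewrite -ve v21.
  have n2 : nobt (map (fun v => (v.1, act g v.2)) ((b, s) :: l)).
    move: ((b, s) :: l) nl {us lout lmin hl h1 h2 n1 sl} => k.
    elim: k => [//|v [//|v' k] IH [vv nk]]; split; last exact: IH.
    move=> [e1 e2]; apply: vv; rewrite [v']surjective_pairing e1 /flip.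
    by rewrite (act_inj e2).
  by have [] := gwalk_unique aY h1 h2 n1 n2.
have [g ug] := rY fixs.
have : D u (size l).
  rewrite -(actK g u) us -ug; apply: Dact; exists l, x; split=> //.
  by case: hl.
by move/lmin; rewrite /= ltnn.
Qed.

(** An edge outside the image has both ends in it; joining them inside the image would close a
    circuit in the tree. *)
Lemma image_surjE s : exists e, mE m e = s.
Proof.
apply: Classical_Prop.NNPP => ns.
have [x xs] := image_surjV (ends true s).
have [y ys] := image_surjV (ends false s).
have [k [hk nk kim]] := image_walk y x.
have hc : gwalk (mV m x) ((true, s) :: k) (mV m x).
  by split; rewrite /= -?ys.
suff nc : nobt ((true, s) :: k) by have := aY hc nc.
case: k kim nk {hk hc} => [//|v k] kim nk; split=> // vs; apply: ns.
have [|e ve] := kim v; first by left.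
by exists e; rewrite -ve vs.
Qed.

(** By injectivity a flow edge maps to an edge of [Y] with the same stabilizer as its origin. As [Y]
    is reduced, its ends lie in one orbit, so being non-root would persist up to the final root. *)
Lemma immersed_flow_root (N : gV X -> Prop) : ginvariant N ->
  forall x, flows N x -> ~ N x.
Proof.
move=> iN x; elim=> {x} [//|b e be _ IH Nx]; apply: IH.
have [|g] := rY (b := b) (s := mE m e).
  move=> g gs; apply: (stab_equi (@mE_equi _ _ _ _ m)); apply: be.
  by apply: immersed_injV; rewrite mV_equi mends.
by rewrite -!mends -mV_equi => /immersed_injV ->; apply: iN.
Qed.

End Immersion.

(** * Folding a Cayley graph onto a reduced tree *)

Section FoldSequence.
Variables (G : Type) (grp : group_on G).
Local Notation "x ** y" := (gmul grp x y) (at level 40, left associativity).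
Local Notation e1 := (gone grp).
Local Notation "x ^!" := (ginv grp x) (at level 1, format "x ^!").
Local Notation stab := (@stab G grp _).
Local Notation ggraph := (ggraph grp).

Definition reg_gset : gset grp :=
  @Gset G grp G (gmul grp) (gmul1 grp) (fun g h x => esym (gmulA grp g h x)).

Definition void_gset : gset grp :=
  @Gset G grp void (fun _ x => x) (fun _ => erefl) (fun _ _ _ => erefl).

Definition sum_act (M M' : gset grp) (g : G) (x : M + M') : M + M' :=
  match x with inl y => inl (act g y) | inr y => inr (act g y) end.

Definition sum_gset (M M' : gset grp) : gset grp.
Proof.
refine (@Gset G grp (M + M')%type (@sum_act M M') _ _).
  by case=> x /=; rewrite act1.
by move=> g h [] x /=; rewrite actM.
Defined.

Variable Y : ggraph.

Definition weighted (X : ggraph) (N : gV X -> Prop) (sE sN r : rat) :=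
  [/\ ginvariant N, forall x, flows N x, osum (fun _ : gE X => True) sE,
      osum N sN & (sE - sN <= r)%R].

(* [X] is a partial Cayley graph over [Y]: it already joins the base vertex [x0]
   to [h x0] for [h] in [hs], and [x] is the tip of a path under construction. *)
Definition cayley (y0 : gV Y) (hs : seq G) (r : rat) (y : gV Y) :=
  exists (X : ggraph) (m : gmor X Y) (N : gV X -> Prop) sE sN (x0 x : gV X),
  [/\ weighted N sE sN r,
   [/\ ~ N x0, mV m x0 = y0, mV m x = y & exists l, gwalk x0 l x],
   (forall v, exists g l, gwalk (act g x0) l v) &
   (forall h, List.In h hs -> exists l, gwalk x0 l (act h x0))].

Lemma cayley_nil y0 : cayley y0 [::] 0%R y0.
Proof.
pose X : ggraph := @GGraph G grp reg_gset void_gset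
  (fun _ x => match x with end) (fun _ _ x => match x with end).
have mVe : equivariant (fun g : reg_gset => act g y0).
  by move=> g x; rewrite -actM.
pose m : gmor X Y := @GMor G grp X Y (fun g : reg_gset => act g y0)
  (fun x : void_gset => match x with end) mVe
  (fun _ x => match x with end) (fun _ x => match x with end).
exists X, m, (fun _ => False), 0%R, 0%R, e1, e1; split=> //.
- split=> //; [by move=> x; apply: flow_root|by apply: osum0; case|by apply: osum0 => x []].
- by split; rewrite //= ?act1 //; exists [::].
- by move=> v; exists v, [::]; rewrite /= mulg1.
Qed.

(** A free orbit of edges is attached at [x], leading to a free orbit of new non-root vertices. The
    two weights cancel, and the new vertices flow back along the new edges. *)
Lemma cayley_spike y0 hs r b (s : gE Y) :
  cayley y0 hs r (ends b s) -> cayley y0 hs r (ends (~~ b) s).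
Proof.
move=> [X [m [N [sE [sN [x0 [x [[iN flN hE hN le] [nx0 mx0 mx [lx wx]] cv ch]]]]]]]].
pose V' := sum_gset (gV X) reg_gset; pose E' := sum_gset (gE X) reg_gset.
pose en (b' : bool) (e : E') : V' := match e with
  | inl e => inl (ends b' e)
  | inr k => if b' == b then inl (act k x) else inr k end.
have ene b' : equivariant (en b').
  move=> g [e|k] /=; first by rewrite ends_equi.
  by case: eqP => _ //=; rewrite actM.
pose X' : ggraph := @GGraph G grp V' E' en ene.
pose fV (v : V') := match v with
  | inl v => mV m v | inr k => act k (ends (~~ b) s) end.
pose fE (e : E') := match e with inl e => mE m e | inr k => act k s end.
have fVe : equivariant fV by move=> g [v|k] /=; rewrite ?mV_equi ?actM.
have fEe : equivariant fE by move=> g [v|k] /=; rewrite ?mE_equi ?actM.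
have fends b' (e : E') : fV (en b' e) = ends b' (fE e).
  case: e => [e|k] /=; first exact: mends.
  case: eqP => [->|nb] /=; first by rewrite mV_equi mx ends_equi.
  have -> : b' = ~~ b by clear -nb; case: b' b nb => -[].
  by rewrite ends_equi.
pose m' : gmor X' Y := @GMor G grp X' Y fV fE fVe fEe fends.
pose N' (v : V') := match v with inl v => N v | inr _ => True end.
pose w := wt (stab (inr e1 : E')).
have wV : wt (stab (inr e1 : V')) = w.
  congr wt; apply: pred_ext => g; rewrite /stab /=.
  by split=> -[ge]; congr inr.
pose i : gmor X X' := @GMor G grp X X' inl inl (fun _ _ => erefl) (fun _ _ => erefl)
  (fun _ _ => erefl).
have wi := gwalk_mor i.
have sinl (M M' : gset grp) (v : M) g : stab (inl v : sum_gset M M') g <-> stab v g.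
  by rewrite /stab /=; split=> [[]|->].
have sinr (M M' : gset grp) (v : M') g : stab (inr v : sum_gset M M') g <-> stab v g.
  by rewrite /stab /=; split=> [[]|->].
have osum_inl (M : gset grp) (P : M -> Prop) (P' : sum_gset M reg_gset -> Prop) t :
    ginvariant P -> (forall v, P' (inl v) <-> P v) -> (forall k, P' (inr k)) ->
    osum P t -> osum P' (wt (stab (inr e1 : sum_gset M reg_gset)) + t)%R.
  move=> iP P1 P2 ht; apply: osumS; first exact: P2.
  apply: (osum_bij (f := inl : M -> sum_gset M reg_gset)) ht => //.
  - by move=> v Pv; split; [apply/P1|case].
  - move=> [v|k] [Pv no]; first by exists v; split=> //; apply/P1.
    by case: no; exists k; rewrite /= mulg1.
  - by move=> v v' _ _ [].
have fl_inl v : flows (N' : gV X' -> Prop) (inl v).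
  elim: (flN v) => {v} [v nv|b' e be _ IH]; first exact: flow_root.
  apply: (@flow_step _ _ X' N' b' (inl e)) => // g.
  by rewrite /= => /sinl /be h; apply/sinl.
exists X', m', N', (w + sE)%R, (w + sN)%R, (inl x0), (inr e1); split.
- split.
  + by move=> g [v|k] //=; apply: iN.
  + move=> [v|k]; first exact: fl_inl.
    have nb : (~~ b == b) = false by case: (b).
    have -> : inr k = ends (~~ b) (inr k : gE X') by rewrite /= nb.
    apply: flow_step; last by rewrite negbK /= eqxx.
    by move=> g; rewrite /= nb => /sinr h; apply/sinr.
  + exact: osum_inl hE.
  + by rewrite -wV; apply: osum_inl hN.
  + by move: le; lra.
- split=> //=; first by rewrite act1.
  exists (mapw i lx ++ [:: (b, inr e1 : gE X')]).
  apply: gwalk_cat (wi _ _ _ wx) _; rewrite /= eqxx act1; split=> //.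
  by case: (b).
- move=> [v|k].
    by have [g [l hl]] := cv v; exists g, (mapw i l); apply: wi hl.
  have [g [l hl]] := cv (act k x).
  exists g, (mapw i l ++ [:: (b, inr k : gE X')]).
  apply: gwalk_cat (wi _ _ _ hl) _; rewrite /= eqxx; split=> //.
  by case: (b).
- by move=> h /ch [l hl]; exists (mapw i l); apply: wi hl.
Qed.

Lemma cayley_walk y0 hs r y l z : gwalk y l z -> cayley y0 hs r y -> cayley y0 hs r z.
Proof.
elim: l y => [y -> //|u l IH y [-> h] c]; apply: IH h _; exact: cayley_spike.
Qed.

(** The tip is identified with the translate by [h] of the base vertex, which is a root. Only the
    weight of the tip ceases to be subtracted, and it is at most 1. *)
Lemma cayley_close y0 hs r h : cayley y0 hs r (act h y0) ->
  cayley y0 (h :: hs) (r + 1)%R y0.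
Proof.
move=> [X [m [N [sE [sN [x0 [x [[iN flN hE hN le] [nx0 mx0 mx [lx wx]] cv ch]]]]]]]].
have mxh : mV m x = mV m (act h x0) by rewrite mV_equi mx mx0.
have [X' [p [m' [mm pI pS mp]]]] := merge_graph mxh.
have flagN : False -> N x /\ N (act h x0) by [].
have hN' := osum_merge mm iN (@mergeNE _ _ _ _ _ _ _ mm N False) hN.
rewrite [ind False _]indF // in hN'.
rewrite [ind (~ _ /\ _) _]indF in hN'; last by rewrite (ginvariantE _ _ iN) => -[].
exists X', m', (mergeN p x N False), sE, (sN - ind (N x) (wt (stab x)) - 0 + 0)%R,
  (mV p x0), (mV p x0); split.
- split; [exact: (invariant_mergeN mm iN)| | |exact: hN'|].
  + apply: (merge_flows mm iN flagN flN).
    by apply: flow_root; rewrite (mergeNE mm); case=> [[]//|[[]]]; apply: orb_refl.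
  + apply: osum_bij hE => //; first exact: mE_equi.
      by move=> y _; have [e <-] := pS y; exists e.
    by move=> ? ? _ _; apply: pI.
  have : (ind (N x) (wt (stab x)) <= 1)%R.
    by rewrite /ind; case: (pselect (N x)) => [?|?] //; apply/wt_le1/subgroup_stab.
  by lra.
- split; rewrite ?mp //; [exact: (mergeN_root mm iN flagN)|by exists [::]].
- move=> v; have [u <-] := merge_surj mm v.
  have [g [l hl]] := cv u; exists g, (mapw p l); rewrite -mV_equi.
  exact: gwalk_mor.
- move=> h' [<-|/ch [l hl]].
    exists (mapw p lx); rewrite -mV_equi -(merge_eq mm); exact: gwalk_mor.
  by exists (mapw p l); rewrite -mV_equi; apply: gwalk_mor.
Qed.

Lemma cayley_exists y0 hs : gconn Y -> cayley y0 hs (size hs)%:R%R y0.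
Proof.
move=> cY; elim: hs => [|h hs IH]; first exact: cayley_nil.
have [l hl] := cY y0 (act h y0).
rewrite /= -natr1; exact: cayley_close (cayley_walk hl IH).
Qed.

Definition fold_state (sE r : rat) :=
  exists (X : ggraph) (m : gmor X Y) (N : gV X -> Prop) sN,
    [/\ weighted N sE sN r, exists x : gV X, True & gconn X].

(** The elements [g] such that [x0] is joined to its translate by [g] form a subgroup containing the
    generators. *)
Lemma cayley_fold_state y0 hs r y : generates grp hs -> cayley y0 hs r y ->
  exists sE, fold_state sE r.
Proof.
move=> gen [X [m [N [sE [sN [x0 [x [wN _ cv ch]]]]]]]].
exists sE, X, m, N, sN; split; [exact: wN|by exists x0|].
have c0 g : exists l, gwalk x0 l (act g x0).
  elim: (gen g) => {g} [g /ch //||g h _ [l hl] _ [k hk]|g _ [l hl]].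
  - by exists [::]; rewrite /= act1.
  - by have := gwalk_cat hl (gwalk_act g hk); rewrite -actM => ?; eexists; eassumption.
  - have := gwalk_act g^! (gwalk_rev hl); rewrite actK => ?; eexists; eassumption.
move=> y1 y2.
have [g1 [l1 h1]] := cv y1; have [g2 [l2 h2]] := cv y2.
have [k1 w1] := c0 g1; have [k2 w2] := c0 g2.
eexists; apply: gwalk_cat (gwalk_rev (gwalk_cat w1 h1)) (gwalk_cat w2 h2).
Qed.

Hypotheses (cY : gconn Y) (aY : gacyclic Y) (rY : greduced Y).
Variable C : nat.
Hypothesis bY : forall s : gE Y, exists n, has_card (stab s) n /\ (n <= C)%N.

(** Edge stabilizers of [X] are contained in those of their images, so their orders are at most [C]
    too. *)
Lemma fold_state_int sE r : fold_state sE r ->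
  exists k : nat, (sE * (C`!)%:R = k%:R)%R.
Proof.
move=> [X [m [N [sN [[_ _ hE _ _] _ _]]]]].
apply: osum_int hE _ => x _; have [n [hn nC]] := bY (mE m x).
have sub g : stab x g -> stab (mE m x) g by apply: stab_equi; apply: mE_equi.
have [|n' hn'] := has_card_sub sub; first by exists n.
exists n'; split=> //; apply: leq_trans nC.
exact: (has_card_inj (f := id)) hn' hn.
Qed.

Lemma fold_state_reduced sE r : fold_state sE r ->
  exists s, osum (fun _ : gE Y => True) s /\ (s <= r)%R.
Proof.
have finY (e : gE Y) : fin (stab e) by have [n [h _]] := bY e; exists n.
move=> h; have [k ek] := fold_state_int h.
(* The induction is on the edge sum in units of 1/C!. *)
elim/ltn_ind: k sE ek h => k IH sE ek [X [m [N [sN [[iN flN hE hN le] neX cX]]]]].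
case: (pselect (immersed m)) => im.
  exists sE; split; last first.
    suff sN0 : sN = 0%R by move: le; rewrite sN0 subr0.
    apply: osum_empty hN _ => x.
    exact: (immersed_flow_root im cX aY rY iN (flN x)).
  apply: osum_bij hE => //; first exact: mE_equi.
    move=> y _; have [e <-] := image_surjE m cX cY aY rY neX y; by exists e.
  by move=> x y _ _; apply: (immersed_injE im cX aY).
have [b [e [f [vef mef ef]]]] : exists b e f,
    [/\ ends b e = ends b f, mE m e = mE m f & e <> f].
  apply: Classical_Prop.NNPP => n; apply: im => b e f vef mef.
  by apply: Classical_Prop.NNPP => ef; apply: n; exists b, e, f.
have [X' [p [m' [N' [sE' [sN' [[pS iN' flN' hE' hN'] [lt le']]]]]]]] :=
  fold_step finY vef mef ef iN flN hE hN.
have st' : fold_state sE' r.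
  exists X', m', N', sN'; split; first by split=> //; lra.
    by case: neX => x _; exists (mV p x).
  move=> y z; have [x <-] := pS y; have [x' <-] := pS z.
  by have [l /(gwalk_mor p) hl] := cX x x'; eexists; eassumption.
have [k' ek'] := fold_state_int st'.
apply: (IH k' _ sE') => //.
rewrite -(ltr_nat rat) -ek -ek' ltr_pM2r // ltr0n; exact: fact_gt0.
Qed.

Lemma reduced_tree_bound hs : (exists y : gV Y, True) -> generates grp hs ->
  exists s, osum (fun _ : gE Y => True) s /\ (s <= (size hs)%:R)%R.
Proof.
move=> [y0 _] gen.
have [sE st] := cayley_fold_state gen (cayley_exists y0 hs cY).
exact: fold_state_reduced st.
Qed.

End FoldSequence.

(** * Collapsing a compressing forest *)

Section Collapse.
Variables (G : Type) (grp : group_on G) (T : Gtree grp).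
Variables (Vb Eb : finType) (pV : vtx T -> Vb) (pE : edg T -> Eb).
Hypothesis HQ : is_quotient pV pE.
Local Notation "x ** y" := (gmul grp x y) (at level 40, left associativity).
Local Notation "x ^!" := (ginv grp x) (at level 1, format "x ^!").
Local Notation twalk := (walk (@src _ _ T) (@Defs.rev _ _ T)).
Local Notation treduced := (Defs.reduced (@Defs.rev _ _ T)).
Local Notation rev := Defs.rev.

Definition vset : gset grp := Gset (@actv1 _ _ T) (@actvM _ _ T).
Definition eset : gset grp := Gset (@acte1 _ _ T) (@acteM _ _ T).

Lemma pV_eq v w : pV v = pV w <-> exists g, w = actv g v.
Proof. by case: HQ => _ [h _]; apply: h. Qed.

Lemma pE_eq e e' : pE e = pE e' <-> exists g, e' = acte g e \/ e' = acte g (rev e).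
Proof. by case: HQ => _ [_ [_ h]]; apply: h. Qed.

Lemma pV_act g v : pV (actv g v) = pV v.
Proof. by symmetry; apply/pV_eq; exists g. Qed.

Lemma pE_act g e : pE (acte g e) = pE e.
Proof. by symmetry; apply/pE_eq; exists g; left. Qed.

Lemma pE_rev e : pE (rev e) = pE e.
Proof. by symmetry; apply/pE_eq; exists (gone grp); right; rewrite acte1. Qed.

Lemma actvK g (v : vtx T) : actv g^! (actv g v) = v.
Proof. exact: (actK g (v : vset)). Qed.

Lemma acteK g (e : edg T) : acte g^! (acte g e) = e.
Proof. exact: (actK g (e : eset)). Qed.

Lemma acteVK g (e : edg T) : acte g (acte g^! e) = e.
Proof. exact: (actVK g (e : eset)). Qed.

Lemma qjoins_edge s : qjoins pV pE (pE s) (pV (src s)) (pV (src (rev s))).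
Proof. by exists s. Qed.

Lemma qwalk_cat x l y k z : qwalk pV pE x l y -> qwalk pV pE y k z ->
  qwalk pV pE x (l ++ k) z.
Proof.
elim: l x => [x /= -> //|e l IH x [w [xw h]] hk].
by exists w; split=> //; apply: IH.
Qed.

Lemma qwalk_split x l e k z : qwalk pV pE x (l ++ e :: k) z ->
  exists y y', [/\ qwalk pV pE x l y, qjoins pV pE e y y' & qwalk pV pE y' k z].
Proof.
elim: l x => [x [y' [h1 h2]]|f l IH x [w [xw /IH [y [y' [h1 h2 h3]]]]]].
  by exists x, y'.
by exists y, y'; split=> //; exists w.
Qed.

Lemma twalk_cat v es w fs u : twalk v es w -> twalk w fs u -> twalk v (es ++ fs) u.
Proof.
elim: es v => [v /= -> //|e es IH v [ev h] hf]; split=> //; exact: IH.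
Qed.

Lemma twalk_reduce v es w : twalk v es w ->
  exists fs, [/\ twalk v fs w, treduced fs & forall e, List.In e fs -> List.In e es].
Proof.
elim: es v => [v /= ->|e es IH v [ev /IH [fs [hf rf fe]]]]; first by exists [::].
have dflt : treduced (e :: fs) -> exists fs', [/\ twalk v fs' w, treduced fs' &
    forall f, List.In f fs' -> List.In f (e :: es)].
  by move=> r; exists (e :: fs); split=> // f [->|/fe]; [left|right].
case: fs hf rf fe dflt => [|f fs] hf rf fe dflt; first exact: dflt.
case: (pselect (f = rev e)) => fre; last by apply: dflt.
exists fs; split.
- by move: hf => [_]; rewrite fre /tgt Defs.revK ev.
- by case: fs rf {hf fe dflt} => [//|f' fs] [].
- by move=> e' h; right; apply: fe; right.
Qed.

Variables (F : {set Eb}) (dir : Eb -> edg T).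
Hypothesis OF : oriented_forest pV pE F dir.

(** No edge lying over [F] is the reverse of one that does not, so backtracking at a junction is
    possible only when [p] is empty. *)
Lemma treduced_insert e p f q : pE e \notin F -> pE f \notin F ->
  (forall s, List.In s p -> pE s \in F) ->
  treduced p -> treduced (f :: q) -> (p = [::] -> f <> rev e) ->
  treduced (e :: p ++ f :: q).
Proof.
move=> eF fF pF rp rq ef.
have : treduced (p ++ f :: q).
  elim: p pF rp {ef} => [//|s [|s' p] IH] pF rp.
    split=> // fs; case/negP: fF; rewrite fs pE_rev; apply: pF; by left.
  case: rp => ss rp; split=> //; apply: IH => // t pt; apply: pF; by right.
case: p pF ef {rp} => [|s p] pF ef h; split=> //; first exact: ef.
move=> se; case/negP: eF; rewrite -(pE_rev e) -se; apply: pF; by left.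
Qed.

(** * Roots of the subtrees to be collapsed *)

Definition up (v : vtx T) (s : edg T) :=
  [/\ src s = v, pE s \in F & exists g, s = acte g (dir (pE s))].

Lemma up_stab v s g : up v s -> actv g v = v -> acte g s = s.
Proof.
case=> sv sF [k sk] gv; case: OF => _ [_ [_ /(_ _ sF) st]].
have kv : actv k (src (dir (pE s))) = v by rewrite -src_act -sk.
have /st : stabV (src (dir (pE s))) (k^! ** g ** k).
  by rewrite /stabV !actvM kv gv -kv actvK.
rewrite /stabE !acteM -sk => h.
by rewrite -(acteVK k (acte g s)) h -sk.
Qed.

Lemma up_act v s g : up v s -> up (actv g v) (acte g s).
Proof.
case=> sv sF [k sk]; split; rewrite ?src_act ?sv ?pE_act //.
by exists (g ** k); rewrite acteM -sk.
Qed.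

Lemma up_pV v s : up v s -> pV (src (dir (pE s))) = pV v.
Proof. by case=> sv sF [k sk]; rewrite -sv sk src_act pV_act -sk. Qed.

(** The orientation gives uniqueness in the quotient; two lifts at [v] differ by an element fixing
    [v], which fixes the edge as the stabilizers agree. *)
Lemma up_unique v s s' : up v s -> up v s' -> s = s'.
Proof.
move=> us us'; have [sv sF [k sk]] := us; have [sv' sF' [k' sk']] := us'.
case: OF => _ [_ [un _]].
have E : pE s = pE s'.
  by apply: un => //; rewrite (up_pV us) (up_pV us').
have ss' : s' = acte (k' ** k^!) s by rewrite acteM {1}sk acteK E.
rewrite ss' (up_stab us) //.
by rewrite -sv -src_act -ss' sv'.
Qed.

(** A relation rather than a function, since following outgoing forest edges ends only because [F]
    has no cycle. *)
Inductive Rt : vtx T -> vtx T -> Prop :=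
 | Rt_root v : (forall s, ~ up v s) -> Rt v v
 | Rt_up v s r : up v s -> Rt (src (rev s)) r -> Rt v r.

Lemma Rt_fun v r r' : Rt v r -> Rt v r' -> r = r'.
Proof.
move=> h; elim: h r' => {v r} [v nv r' h|v s r us _ IH r' h].
  by case: h nv => // {}v s {}r us _ /(_ s).
case: h us IH => {v r'} [v nv /nv //|v s' r' us' h us IH].
by apply: IH; rewrite (up_unique us us').
Qed.

Lemma Rt_act g v r : Rt v r -> Rt (actv g v) (actv g r).
Proof.
elim=> {v r} [v nv|v s r us _ IH].
  apply: Rt_root => s us; apply: (nv (acte g^! s)).
  by rewrite -(actvK g v); apply: up_act.
apply: (Rt_up (up_act g us)).
by rewrite rev_act src_act.
Qed.

(* Following outgoing forest edges never returns to a visited vertex of the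
   quotient, as this would close a cycle of [F]. *)
Lemma Rt_total v : exists r, Rt v r.
Proof.
(* [A] holds the visited vertices, and [n] bounds the number of the others. Each visited vertex is
   joined to the current one by edges leaving visited vertices, so the next edge is new and extends
   the walk without repetition. *)
suff H n (A : {set Vb}) w : (#|~: A| <= n)%N -> pV w \notin A ->
    (forall x, x \in A -> exists l, [/\ uniq l, forall e, e \in l -> e \in F,
       forall e, e \in l -> pV (src (dir e)) \in A & qwalk pV pE x l (pV w)]) ->
    exists r, Rt w r.
  apply: (H #|~: (set0 : {set Vb})| set0 v) => //; first by rewrite inE.
  by move=> x; rewrite inE.
elim: n A w => [|n IH] A w An wA hA.
  by move: An; rewrite leqn0 cards_eq0 => /eqP/setP/(_ (pV w)); rewrite !inE wA.
case: (pselect (exists s, up w s)) => [[s us]|ns]; last first.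
  by exists w; apply: Rt_root => s us; apply: ns; exists s.
have [sw sF _] := us.
have js : qwalk pV pE (pV w) [:: pE s] (pV (src (rev s))).
  by exists (pV (src (rev s))); split=> //; rewrite -sw; apply: qjoins_edge.
have hA' x : x \in pV w |: A -> exists l, [/\ l <> [::], uniq l,
    forall e, e \in l -> e \in F,
    forall e, e \in l -> pV (src (dir e)) \in pV w |: A &
    qwalk pV pE x l (pV (src (rev s)))].
  rewrite !inE => /orP [/eqP ->|/hA [l [ul lF lA hl]]].
    exists [:: pE s]; split=> // e; rewrite inE => /eqP -> //.
    by rewrite !inE (up_pV us) eqxx.
  exists (l ++ [:: pE s]); split.
  - by case: (l).
  - rewrite cat_uniq ul /= orbF andbT; apply/negP => /lA.
    by rewrite (up_pV us) (negPf wA).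
  - by move=> e; rewrite mem_cat inE => /orP [/lF|/eqP ->].
  - move=> e; rewrite mem_cat !inE => /orP [/lA ->|/eqP ->]; first by rewrite orbT.
    by rewrite (up_pV us) eqxx.
  - exact: qwalk_cat hl js.
have [|||r hr] := IH (pV w |: A) (src (rev s)).
- rewrite -ltnS; apply: leq_trans An; apply: proper_card; rewrite properC.
  by apply/properP; split; [exact: subsetUr|exists (pV w); rewrite ?inE ?eqxx].
- apply/negP => /hA' [l [l0 ul lF _ hl]]; case: OF => nc _; apply: nc.
  by exists (pV (src (rev s))), l.
- by move=> x /hA' [l [_ ul lF lA hl]]; exists l.
by exists r; apply: Rt_up us hr.
Qed.

Definition rt v := sval (constructive_indefinite_description _ (Rt_total v)).

Lemma rtP v : Rt v (rt v).
Proof. by rewrite /rt; case: constructive_indefinite_description. Qed.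

Lemma rt_eq v r : Rt v r -> rt v = r.
Proof. exact: Rt_fun (rtP v). Qed.

Lemma rt_act g v : rt (actv g v) = actv g (rt v).
Proof. by apply: rt_eq; apply: Rt_act; apply: rtP. Qed.

Lemma rt_rt v : rt (rt v) = rt v.
Proof. by apply: rt_eq; elim: (rtP v) => {v} // v nv; apply: Rt_root. Qed.

Lemma up_or_up s : pE s \in F -> up (src s) s \/ up (src (rev s)) (rev s).
Proof.
move=> sF; have [_ [dE _]] := OF.
have /pE_eq [g [sg|sg]] := dE _ sF; first by left; split=> //; exists g.
right; split=> //; rewrite pE_rev //; exists g.
by rewrite {1}sg rev_act Defs.revK.
Qed.

Lemma rt_F s : pE s \in F -> rt (src s) = rt (src (rev s)).
Proof.
move=> /up_or_up [us|us].
  by apply: rt_eq; apply: (Rt_up us); apply: rtP.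
by symmetry; apply: rt_eq; apply: (Rt_up us); rewrite Defs.revK; apply: rtP.
Qed.

(** Climb from [v] to the common root, descend to [w], and reduce. *)
Lemma Fpath v w : rt v = rt w ->
  exists es, [/\ twalk v es w, treduced es & forall s, List.In s es -> pE s \in F].
Proof.
move=> vw.
have upw u r : Rt u r -> exists es fs, [/\ twalk u es r, twalk r fs u,
    forall s, List.In s es -> pE s \in F & forall s, List.In s fs -> pE s \in F].
  elim=> {u r} [u _|u s r us _ [es [fs [h1 h2 eF fF]]]]; first by exists [::], [::].
  have [su sF _] := us; exists (s :: es), (fs ++ [:: rev s]); split.
  - by split.
  - by apply: twalk_cat h2 _; split; rewrite // /tgt Defs.revK.
  - by move=> t [<- //|/eF].
  - by move=> t /List.in_app_iff [/fF //|[<-|[]]]; rewrite pE_rev.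
have [es [_ [h1 _ eF _]]] := upw _ _ (rtP v).
have [_ [fs [_ h2 _ fF]]] := upw _ _ (rtP w).
rewrite vw in h1; have [k [hk rk kef]] := twalk_reduce (twalk_cat h1 h2).
by exists k; split=> // s /kef /List.in_app_iff [/eF|/fF].
Qed.

(** Roots are constant along edges over [F], so a walk of [F] in the quotient cannot leave the orbit
    of a root. This detects the cycles that a new edge would create. *)
Lemma qwalk_orb x l y v w : qwalk pV pE x l y -> (forall e, e \in l -> e \in F) ->
  pV v = x -> pV w = y -> exists g, rt w = actv g (rt v).
Proof.
elim: l x v => [x v /= xy _ vx wy|e l IH x v [z [[s [se [sx sz]]] h]] lF vx wy].
  by move: vx; rewrite xy -wy => /pV_eq [g ->]; exists g; rewrite rt_act.
have [|g wg] := IH z (src (rev s)) h _ sz wy.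
  by move=> f fl; apply: lF; rewrite inE fl orbT.
move: vx; rewrite -sx => /pV_eq [k sk]; exists (g ** k).
rewrite wg -rt_F; first by rewrite sk rt_act actvM.
by rewrite se; apply: lF; rewrite inE eqxx.
Qed.

(* Reversing the edges on the path from [v] to its root makes [v] a root. *)
Lemma reroot v r : Rt v r -> (forall g, stabV r g -> stabV v g) ->
  exists dir', oriented_forest pV pE F dir' /\
    forall e, e \in F -> pV (src (dir' e)) <> pV v.
Proof.
elim=> {v r} [v nv _|v s r us hr IH rv].
  exists dir; split=> // e eF /pV_eq [g vg].
  have [_ [dE _]] := OF.
  by apply: (nv (acte g (dir e))); split; rewrite ?src_act ?pE_act ?dE //; exists g.
have [sv sF _] := us.
have st g : stabV (src (rev s)) g -> stabE s g.
  move=> gt; apply: (up_stab us); apply: rv.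
  by rewrite /stabV -(rt_eq hr) -rt_act gt.
have [|dir' [[nc [dE [un sd]]] root']] := IH.
  move=> g /rv gv; rewrite /stabV -src_act -rev_act.
  by rewrite (up_stab us gv).
(* The edge is still oriented away from [v], since no edge leaves its other end in [dir']; it can
   now be reversed. *)
have [g dg] : exists g, dir' (pE s) = acte g s.
  have /esym/pE_eq [g [dg|dg]] := dE _ sF; first by exists g.
  by case: (root' _ sF); rewrite dg src_act pV_act.
exists (fun e => if e == pE s then rev s else dir' e); split.
  split=> //; split; [|split].
  - by move=> e eF; case: eqP => [->|_]; [rewrite pE_rev|apply: dE].
  - move=> e e' eF eF'; case: eqP => [->|_]; case: eqP => [->//|_].
    + by move/esym/(root' _ eF').
    + by move/(root' _ eF).
    + exact: un.
  - move=> e eF k; case: eqP => [_|_]; last exact: sd.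
    split; first by move=> h; rewrite /stabV -src_act h.
    by move=> /st h; rewrite /stabE -rev_act h.
move=> e eF; case: eqP => [_ tv|ne].
  apply: nc; exists (pV v), [:: pE s]; split=> //; split=> //; split.
    by move=> f; rewrite inE => /eqP ->.
  by exists (pV v); split=> //; rewrite -{2}tv -sv; apply: qjoins_edge.
move=> ev; apply: ne; apply: un => //.
by rewrite ev dg src_act pV_act sv.
Qed.

Hypothesis maxF : forall F' : {set Eb}, F \proper F' ->
  ~ exists dir, oriented_forest pV pE F' dir.

(** Otherwise the root has the stabilizer condition required by [reroot], so the forest can be
    reoriented with no edge leaving [src s]. Adding [s], oriented away from [src s], then gives a
    larger forest, against maximality. *)
Lemma collapse_reduced s : pE s \notin F ->
  (forall g, stabV (rt (src s)) g -> stabE s g) ->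
  exists g, rt (src (rev s)) = actv g (rt (src s)).
Proof.
move=> sF st; apply: Classical_Prop.NNPP => no.
have sst g : stabV (rt (src s)) g -> stabV (src s) g.
  by move=> /st h; rewrite /stabV -src_act h.
have [dir' [[nc [dE [un sd]]] root']] := reroot (rtP (src s)) sst.
apply: (maxF (F' := pE s |: F)).
  by apply/properP; split; [exact: subsetUr|exists (pE s); rewrite ?inE ?eqxx].
exists (fun e => if e == pE s then s else dir' e).
have FE e : e \in pE s |: F -> e <> pE s -> e \in F.
  by rewrite !inE => /orP [/eqP -> //|].
split; [|split; [|split]].
- move=> [x [l [l0 [ul [lF hl]]]]].
  case sl : (pE s \in l); last first.
    apply: nc; exists x, l; split=> //; split=> //; split=> // e el.
    by apply: FE; [exact: lF|move=> es; rewrite -es el in sl].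
  (* Cutting a cycle at the new edge leaves a walk of [F] between its ends, so their roots would lie
     in one orbit. *)
  case/splitPr: sl ul lF hl => l1 l2 ul lF hl {l0}.
  have [y [y' [h1 [t [ts [ty ty']]] h2]]] := qwalk_split hl.
  move: ul; rewrite cat_uniq /= negb_or => /and3P [_ /andP [sl1 _] /andP [sl2 _]].
  have [|g tg] := qwalk_orb (qwalk_cat h2 h1) _ ty' ty.
    move=> e el; have le : e \in l1 ++ pE s :: l2.
      by move: el; rewrite !mem_cat inE => /orP [->|->]; rewrite ?orbT.
    apply: (FE _ (lF _ le)) => es; move: el.
    by rewrite es mem_cat (negPf sl1) (negPf sl2).
  apply: no; case/esym/pE_eq: ts => k [tk|tk].
    move: tg; rewrite /tgt tk rev_act !src_act !rt_act -!actvM => tg.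
    by exists ((g ** k)^! ** k); rewrite actvM tg actvK.
  move: tg; rewrite /tgt tk rev_act Defs.revK !src_act !rt_act => tg.
  by exists (k^! ** (g ** k)); rewrite !actvM -tg actvK.
- by move=> e eF; case: eqP => [->//|ne]; apply/dE/FE.
- move=> e e' eF eF'; case: eqP => [->|ne]; case: eqP => [->//|ne'].
  + by move/esym/(root' _ (FE _ eF' ne')).
  + by move/(root' _ (FE _ eF ne)).
  + by apply: un; apply: FE.
- move=> e eF g; case: eqP => [_|ne]; last by apply: sd; apply: FE.
  split; first by move=> h; rewrite /stabV -src_act h.
  by move=> h; apply: st; rewrite /stabV -rt_act h.
Qed.


(** * The collapsed graph *)

Definition cV_act g (x : {v | rt v = v}) : {v | rt v = v} :=
  exist (fun v => rt v = v) (actv g (sval x))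
    (etrans (rt_act g (sval x)) (f_equal (actv g) (svalP x))).

(** Each collapsed subtree is represented by its root, which avoids a quotient type. *)
Definition cV : gset grp.
Proof.
refine (@Gset G grp {v | rt v = v} cV_act _ _).
  by move=> x; apply: exist_inj; rewrite /= actv1.
by move=> g h x; apply: exist_inj; rewrite /= actvM.
Defined.

(* [lift] chooses an invariant orientation of the tree. *)
Definition lift y := sval (constructive_indefinite_description _ (proj1 (proj2 (proj2 HQ)) y)).

Lemma pE_lift y : pE (lift y) = y.
Proof. by rewrite /lift; case: constructive_indefinite_description. Qed.

Definition cedge s := pE s \notin F /\ exists g, s = acte g (lift (pE s)).

Lemma cedge_act g s : cedge s -> cedge (acte g s).
Proof.
move=> [sF [k sk]]; split; rewrite pE_act //.
by exists (g ** k); rewrite acteM -sk.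
Qed.

Definition cE_act g (x : {s | cedge s}) : {s | cedge s} :=
  exist cedge (acte g (sval x)) (cedge_act g (svalP x)).

Definition cE : gset grp.
Proof.
refine (@Gset G grp {s | cedge s} cE_act _ _).
  by move=> x; apply: exist_inj; rewrite /= acte1.
by move=> g h x; apply: exist_inj; rewrite /= acteM.
Defined.

Definition cv v : cV := exist (fun v => rt v = v) (rt v) (rt_rt v).

Definition oedge (u : bool * cE) : edg T := if u.1 then sval u.2 else rev (sval u.2).

Definition collapse : ggraph grp.
Proof.
refine (@GGraph G grp cV cE (fun b s => cv (src (oedge (b, s)))) _).
move=> b g s; apply: exist_inj; rewrite /= -rt_act -src_act /oedge /=.
by case: b; rewrite ?rev_act.
Defined.

Lemma oedge_flip u : oedge (flip u) = rev (oedge u).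
Proof. by case: u => -[] s; rewrite /oedge /= ?Defs.revK. Qed.

Lemma oedge_notin u : pE (oedge u) \notin F.
Proof.
by case: u => -[] [s hs]; rewrite /oedge /= ?pE_rev; case: hs.
Qed.

(** As the action has no inversions, a chosen edge is never the reverse of a chosen edge. *)
Lemma oedge_inj : injective oedge.
Proof.
have no (s s' : cE) : sval s <> rev (sval s').
  case: s s' => [s [_ [g sg]]] [s' [_ [g' sg']]] /= ss'.
  have E : pE s = pE s' by rewrite ss' pE_rev.
  apply: (@no_inversion _ _ T (g'^! ** g) (lift (pE s))).
  have sl : s = acte g' (rev (lift (pE s))) by rewrite -rev_act E -sg'.
  by rewrite acteM -sg {1}sl acteK.
move=> [[] s] [[] s']; rewrite /oedge /= => h.
- by congr (_, _); apply: exist_inj.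
- by case: (no _ _ h).
- by case: (no _ _ (esym h)).
- by congr (_, _); apply: exist_inj; rewrite -[LHS]Defs.revK h Defs.revK.
Qed.

Lemma oedge_surj s : pE s \notin F -> exists u, oedge u = s.
Proof.
move=> sF; have /pE_eq [g [sg|sg]] := pE_lift (pE s).
  have cs : cedge s by split=> //; exists g.
  by exists (true, exist _ s cs).
have cs : cedge (rev s).
  split; rewrite pE_rev //; exists g.
  by rewrite {1}sg rev_act Defs.revK.
by exists (false, exist _ (rev s) cs); rewrite /oedge /= Defs.revK.
Qed.

Lemma collapse_conn : gconn collapse.
Proof.
have H v es w : twalk v es w -> exists l, @gwalk _ _ collapse (cv v) l (cv w).
  elim: es v => [v /= ->|s es IH v [<- /IH [l hl]]]; first by exists [::].
  case: (boolP (pE s \in F)) => sF.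
    exists l; suff -> : cv (src s) = cv (tgt (@src _ _ T) (@Defs.rev _ _ T) s) by [].
    by apply: exist_inj; rewrite /= rt_F.
  have [u us] := oedge_surj sF; exists (u :: l); split.
    by rewrite /= -us -surjective_pairing.
  move: hl; rewrite /tgt -us -oedge_flip; by case: (u).
move=> x y.
have cvK (z : cV) : cv (sval z) = z by apply: exist_inj; exact: (svalP z).
have [_ [conn _]] := tree_ax T; have [es /H] := conn (sval x) (sval y).
by rewrite !cvK.
Qed.

(** Consecutive edges are joined in [T] by reduced paths over [F]. The endpoint [w] is free within
    its collapsed subtree, so a closed walk can be lifted to a closed walk. *)
Lemma collapse_lift_walk u l (x y : gV collapse) w :
  gwalk x (u :: l) y -> nobt (u :: l) -> rt w = sval y ->
  exists es, twalk (src (oedge u)) (oedge u :: es) w /\ treduced (oedge u :: es).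
Proof.
elim: l u x => [|u2 l IH] u x [_ h] nb wy.
  have : rt (src (rev (oedge u))) = rt w.
    by rewrite wy -h /= -oedge_flip; case: (u).
  move=> /Fpath [es [he re eF]]; exists es; split; first by split.
  case: es re eF {he} => [//|s es] re eF; split=> // su.
  case/negP: (oedge_notin u); rewrite -(pE_rev (oedge u)) -su; apply: eF; by left.
have [es [he re]] := IH u2 _ h nb.2 wy.
have : rt (src (rev (oedge u))) = rt (src (oedge u2)).
  have /(f_equal sval) /= := h.1.
  by rewrite -oedge_flip -surjective_pairing.
move=> /Fpath [p [hp rp pF]].
exists (p ++ oedge u2 :: es); split.
  by split=> //; apply: twalk_cat hp he.
apply: treduced_insert => //; try exact: oedge_notin.
by move=> _; rewrite -oedge_flip => /oedge_inj; apply: nb.1.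
Qed.

Lemma collapse_acyclic : gacyclic collapse.
Proof.
move=> x [//|u l] h nb.
have ux : rt (src (oedge u)) = sval x.
  by have /(f_equal sval) /= -> := h.1; rewrite -surjective_pairing.
have [es [he re]] := collapse_lift_walk h nb ux.
have [_ [_ ac]] := tree_ax T.
by have := ac _ _ he re.
Qed.

Lemma collapse_stab (s : gE collapse) g : stab s g <-> stabE (sval s) g.
Proof.
rewrite /stab /stabE /=; split=> [/(f_equal sval) //|h]; exact: exist_inj.
Qed.

Lemma collapse_greduced : greduced collapse.
Proof.
move=> b s st.
have [|g hg] := @collapse_reduced (oedge (b, s)) (oedge_notin _).
  move=> g hg; have /collapse_stab : stab s g.
    by apply: st; apply: exist_inj; rewrite /= hg.
  rewrite /stabE /oedge /= => sg; case: (b) => //.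
  by rewrite -rev_act sg.
exists g; apply: exist_inj; rewrite /= -hg -oedge_flip //.
Qed.

Variable c : Eb -> nat.
Hypothesis Hc : forall et : edg T, has_card (stabE et) (c (pE et)).

Lemma collapse_card (s : gE collapse) : has_card (stab s) (c (pE (sval s))).
Proof.
suff -> : stab s = stabE (sval s) by exact: Hc.
by apply: pred_ext => g; apply: collapse_stab.
Qed.

(** Edges of the collapsed graph over one class form a single orbit; [A] is general so that the
    induction can remove the classes one at a time. *)
Lemma collapse_osum (P : gE collapse -> Prop) r (A : {set Eb}) :
  osum P r -> (forall y, y \in A -> y \notin F) ->
  (forall s, P s <-> pE (sval s) \in A) ->
  r = (\sum_(y in A) ((c y)%:R : rat)^-1)%R.
Proof.
move=> h; elim: h A => {P r} [P nP|P p r Pp _ IH] A AF PA.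
  rewrite big_pred0 // => y; apply/negP => yA.
  have cs : cedge (lift y).
    by split; rewrite pE_lift ?AF //; exists (gone grp); rewrite acte1.
  by apply: (nP (exist _ _ cs)); apply/PA; rewrite /= pE_lift.
rewrite (wtE (collapse_card p)) (bigD1 (pE (sval p))) /=; last exact/PA.
congr (_ + _)%R; rewrite (IH (A :\ pE (sval p))).
- by apply: eq_bigl => y; rewrite !inE andbC.
- by move=> y; rewrite !inE => /andP [_ /AF].
move=> s; rewrite !inE PA; split=> [[sA no]|/andP [ne sA]].
  rewrite sA andbT; apply/eqP => sp; apply: no.
  case: (svalP s) => _ [g sg]; case: (svalP p) => _ [k pk].
  exists (g ** k^!); apply: exist_inj; rewrite /= acteM {1}pk acteK -sp -sg //.
by split=> // -[g sg]; case/eqP: ne; rewrite sg /= pE_act.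
Qed.

End Collapse.

Theorem theorem2p3 (G : Type) (grp : group_on G) (d : nat)
  (Hd : min_num_generators grp d)
  (T : Gtree grp) (Vb Eb : finType) (pV : vtx T -> Vb) (pE : edg T -> Eb)
  (HQ : is_quotient pV pE)
  (c : Eb -> nat) (Hc : forall et : edg T, has_card (stabE et) (c (pE et)))
  (F : {set Eb}) (HF : compressing_forest pV pE F) :
  (\sum_(e : Eb | e \notin F) ((c e)%:R : rat)^-1 <= d%:R)%R.
Proof.
have [[dir OF] maxF] := HF; have [[hs [<- gen]] _] := Hd.
pose Y := collapse HQ OF.
have bY (s : gE Y) : exists n, has_card (stab s) n /\ (n <= \max_y c y)%N.
  exists (c (pE (sval s))); split; first exact: collapse_card.
  exact: (leq_bigmax (F := c)).
have [[v _] _] := tree_ax T.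
have [r [hr le]] := reduced_tree_bound (@collapse_conn _ _ _ _ _ _ _ HQ _ _ OF)
  (@collapse_acyclic _ _ _ _ _ _ _ HQ _ _ OF)
  (collapse_greduced (HQ := HQ) (OF := OF) maxF) bY
  (ex_intro _ (cv HQ OF v : gV Y) I) gen.
rewrite (eq_bigl (fun y => y \in ~: F)); last by move=> y; rewrite inE.
rewrite -(collapse_osum Hc hr) // => [y|s]; first by rewrite inE.
by rewrite inE; split=> // _; case: (svalP s).
Qed.
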